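(* Let $k$ be a positive integer. There exists a constant $C_3>0$ such that for every $p\ge \frac{C_3\ln n}{n}$ and every sufficiently large integer $n$, Maker has an efficient (polynomial-time, possibly randomized) strategy for the $p$-random-turn $k$-vertex-connectivity game $\mathcal{C}^k_p$ played on $E(K_n)$ which is w.h.p. a winning strategy.
   Context: In a $p$-random-turn Maker-Breaker game ($0\le p=p(n)\le 1$) played on the edge set $E(K_n)$ of the complete graph, two players, Maker and Breaker, claim previously unclaimed edges. Before each turn a biased coin is tossed, independently of all other turns: with probability $p$ Maker plays this turn, and with probability $1-p$ Breaker plays it; the chosen player claims exactly one unclaimed edge. The game lasts until all edges are claimed. In the game $\mathcal{C}^k_p$ Maker wins if the edges he claimed contain the edge set of a spanning $k$-vertex-connected subgraph of $K_n$; otherwise Breaker wins. A strategy of a player prescribes (possibly using randomization) his next move on the basis of the history of the game so far; it is efficient if each move can be computed in time polynomial in $n$. ''W.h.p.'' (the paper's ''typically'') means with probability tending to $1$ as $n\to\infty$ (over the coin tosses and any randomness of the strategy), against any strategy of the opponent. *)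

(* Defs.v *)
From mathcomp Require Import all_boot all_order all_algebra.

Set Implicit Arguments.
Unset Strict Implicit.
Unset Printing Implicit Defensive.

Import Order.TTheory GRing.Theory Num.Theory.
Local Open Scope ring_scope.

(* The edge {i, j} of K_n is represented by the pair (i, j) with i < j. *)
Notation edge n := {e : 'I_n * 'I_n | (e.1 < e.2)%N}.

Definition adjacent n (F : {set edge n}) : rel 'I_n :=
  fun u v => [exists e in F, (val e == (u, v)) || (val e == (v, u))].

(* Vertex connectivity of the spanning subgraph ([n], F): it has more than k
   vertices, and deleting fewer than k of them never disconnects it. *)
Definition k_connected n (k : nat) (F : {set edge n}) : bool :=
  (k < n)%N &&
  [forall X : {set 'I_n}, (#|X| < k)%N ==>
    [forall u in ~: X, forall v in ~: X,
      connect [rel x y | [&& x \notin X, y \notin X & adjacent F x y]] u v]].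

(* A turn is (true, e) if Maker claimed e, and (false, e) if Breaker did.
   Histories are in chronological order. *)
Notation turn n := (bool * edge n)%type.

Definition history (n : nat) : Type := seq (turn n).

Definition claimed n (h : history n) : seq (edge n) := [seq x.2 | x <- h].

Definition legal n (h : history n) : bool := uniq (claimed h).

Definition maker_edges n (h : history n) : {set edge n} :=
  [set e | (true, e) \in h].

Definition maker_wins n (k : nat) (h : history n) : bool :=
  [exists F : {set edge n}, (F \subset maker_edges h) && k_connected k F].

(* A randomized strategy of either player: after every legal history that
   leaves a free edge, a probability distribution on the free edges. *)
Record strategy (R : numDomainType) (n : nat) := Strategy {
  move_prob :> history n -> edge n -> R;
  _ : forall h, legal h -> (size h < #|{: edge n}|)%N ->
      [/\ forall e, 0 <= move_prob h e,
          forall e, e \in claimed h -> move_prob h e = 0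
        & \sum_e move_prob h e = 1]
}.

Section Game.
Variables (R : numDomainType) (n : nat) (p : R) (M B : strategy R n).

Definition turn_prob (past : history n) (x : turn n) : R :=
  if x.1 then p * M past x.2 else (1 - p) * B past x.2.

Definition play_prob (h : #|{: edge n}|.-tuple (turn n)) : R :=
  \prod_(i < #|{: edge n}|) turn_prob (take i h) (tnth h i).

Definition maker_win_prob (k : nat) : R :=
  \sum_(h : #|{: edge n}|.-tuple (turn n) | maker_wins k h) play_prob h.

End Game.

(* Randomized random access machines, as while programs with unit cost per
   command.  The arithmetic is addition and truncated subtraction, without
   multiplication, so that a fixed program lengthens the numbers it handles by
   O(1) bits per step, and the running time is polynomially related to that of
   a Turing machine. *)
Inductive expr : Type :=
  | Const of nat
  | Input of expr            (* cell of the read-only input *)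
  | Mem of expr              (* cell of the memory, by indirect addressing *)
  | Plus of expr & expr
  | Minus of expr & expr.

Inductive cmd : Type :=
  | Skip
  | Assign of expr & expr    (* Mem[e1] := e2 *)
  | Toss of expr             (* Mem[e] := a fair random bit *)
  | Seq of cmd & cmd
  | If of expr & cmd & cmd   (* nonzero means true *)
  | While of expr & cmd.

Definition memory : Type := nat -> nat.

Definition write (m : memory) (a x : nat) : memory :=
  fun b => if b == a then x else m b.

Fixpoint eval (inp : seq nat) (m : memory) (e : expr) : nat :=
  match e with
  | Const x => x
  | Input e1 => nth 0%N inp (eval inp m e1)
  | Mem e1 => m (eval inp m e1)
  | Plus e1 e2 => (eval inp m e1 + eval inp m e2)%N
  | Minus e1 e2 => (eval inp m e1 - eval inp m e2)%N
  end.

(* The commands still to be executed, the memory, and the unused random bits;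
   the machine has halted when no command is left. *)
Record config : Type :=
  Config { todo : seq cmd; cells : memory; bits : seq bool }.

Definition step (inp : seq nat) (s : config) : config :=
  let: Config cs m w := s in
  if cs is c :: cs' then
    match c with
    | Skip => Config cs' m w
    | Assign e1 e2 => Config cs' (write m (eval inp m e1) (eval inp m e2)) w
    | Toss e => Config cs' (write m (eval inp m e) (head false w)) (behead w)
    | Seq c1 c2 => Config (c1 :: c2 :: cs') m w
    | If e c1 c2 =>
        Config ((if eval inp m e != 0%N then c1 else c2) :: cs') m w
    | While e c1 =>
        Config (if eval inp m e != 0%N then c1 :: cs else cs') m w
    end
  else s.

Definition run (P : cmd) (inp : seq nat) (w : seq bool) (t : nat) : config :=
  iter t (step inp) (Config [:: P] (fun=> 0%N) w).

Definition encode_turn n (x : turn n) : seq nat :=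
  [:: nat_of_bool x.1; nat_of_ord (val x.2).1; nat_of_ord (val x.2).2].

Definition encode n (h : history n) : seq nat :=
  [:: n, size h & flatten [seq encode_turn x | x <- h]].

(* The edge {i, j}, i < j, is output by halting with i and j in the cells
   0 and 1. *)
Definition outputs n (s : config) (e : edge n) : bool :=
  [&& nilp (todo s), cells s 0%N == (val e).1 & cells s 1%N == (val e).2].

(* One program, given n and the history, samples the next move within n ^ d
   steps.  It tosses at most one coin per step, so n ^ d random bits suffice. *)
Definition efficient (R : numFieldType) (S : forall n, strategy R n) : Prop :=
  exists (P : cmd) (d n0 : nat), forall n, (n0 <= n)%N ->
  forall h : history n, legal h -> (size h < #|{: edge n}|)%N ->
    (forall w : (n ^ d).-tuple bool,
        exists e : edge n, outputs (run P (encode h) w (n ^ d)) e) /\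
    (forall e : edge n,
        S n h e = #|[set w : (n ^ d).-tuple bool |
                       outputs (run P (encode h) w (n ^ d)) e]|%:R
                  / 2 ^+ (n ^ d)).

(* Main.v *)
From mathcomp Require Import all_boot all_order all_algebra.
From mathcomp Require Import all_classical all_reals all_analysis.
From mathcomp Require Import zify ring lra.
Require Import Defs.
Import Order.TTheory GRing.Theory Num.Theory.
Set Implicit Arguments.
Unset Strict Implicit.
Unset Printing Implicit Defensive.

(* Cut the vertices into k parts. If Maker connects every part and joins every
   vertex to every part, his graph is k-connected, since removing fewer than k
   vertices leaves some part untouched. For each part, Maker keeps one label in
   each class of vertices that he has connected inside the part, and a vertex
   outside the part is its own label until he joins it to the part. A label v is
   active if at least n / (3 k) vertices of the part do not have the label v,
   and its danger is the number of Breaker's edges from v to the part. Maker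
   plays a free edge from a most dangerous active label to a vertex of the part
   with another label, and of the two merged labels the less dangerous survives.

   The sum of (1 + p / 2) ^ (danger - n / (3 k)) over the active labels does not
   increase in expectation as long as it is less than 1: a move of Maker removes
   a largest term, and a move of Breaker raises only two dangers by one each,
   which adds at most p times a largest term. While no danger reaches n / (3 k),
   an active label has a free edge to play, and when all edges are claimed with
   no active label left, Maker has won. So he fails with probability at most
   n k (1 + p / 2) ^ (- n / (3 k)). The strategy involves neither p nor
   randomness, and a direct simulation of the labels computes it in polynomial
   time. *)

(** * Random-turn games *)

Lemma legal_rcons n (h : history n) x :
  legal (rcons h x) = (x.2 \notin claimed h) && legal h.
Proof. by rewrite /legal /claimed map_rcons rcons_uniq. Qed.

Lemma free_edge n (h : history n) : legal h -> (size h < #|{: edge n}|) ->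
  exists e, e \notin claimed h.
Proof.
move=> lh sh; apply/existsP; apply: contraTT sh; rewrite negb_exists => /forallP H.
rewrite -leqNgt -(size_map snd h) -/(claimed h) -(card_uniqP lh).
by apply/subset_leq_card/fintype.subsetP => e _; apply/negPn.
Qed.

Section Game.
Local Open Scope ring_scope.
Variables (R : numDomainType) (n : nat) (p : R) (M B : strategy R n).
Hypothesis p01 : 0 <= p <= 1.

Let N := #|{: edge n}|.

Lemma strategyP (S : strategy R n) h : legal h -> (size h < N)%N ->
  [/\ forall e, 0 <= S h e, forall e, e \in claimed h -> S h e = 0
    & \sum_e S h e = 1].
Proof. by case: S => f /= H; apply: H. Qed.

Lemma turn_prob_ge0 h x : legal h -> (size h < N)%N -> 0 <= turn_prob p M B h x.
Proof.
move=> lh sh; have [M0 _ _] := strategyP M lh sh; have [B0 _ _] := strategyP B lh sh.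
by case/andP: p01 => p0 p1; rewrite /turn_prob; case: ifP; rewrite mulr_ge0 // subr_ge0.
Qed.

Lemma turn_prob_claimed h x : legal h -> (size h < N)%N -> x.2 \in claimed h ->
  turn_prob p M B h x = 0.
Proof.
move=> lh sh xh; have [_ M0 _] := strategyP M lh sh; have [_ B0 _] := strategyP B lh sh.
by rewrite /turn_prob; case: ifP; rewrite ?M0 ?B0 // mulr0.
Qed.

Lemma sum_turn_prob h (F : turn n -> R) :
  \sum_x turn_prob p M B h x * F x =
  p * (\sum_e M h e * F (true, e)) + (1 - p) * (\sum_e B h e * F (false, e)).
Proof.
rewrite (eq_bigr (fun x => turn_prob p M B h (x.1, x.2) * F (x.1, x.2))); last by case.
rewrite -(pair_bigA _ (fun b e => turn_prob p M B h (b, e) * F (b, e))) /=.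
rewrite big_bool /= !mulr_sumr; congr (_ + _); apply: eq_bigr => e _;
  by rewrite /turn_prob /= mulrA.
Qed.

(** The product in [play_prob] runs over prefixes of a complete play; peeling turns off the front
    instead allows an induction on the number of turns still to come. *)
Fixpoint continue_prob (past h : history n) : R :=
  if h is x :: h' then turn_prob p M B past x * continue_prob (rcons past x) h'
  else 1.

Lemma continue_probE (h : N.-tuple (turn n)) :
  play_prob p M B h = continue_prob [::] h.
Proof.
suff gen m (t : m.-tuple (turn n)) past :
    \prod_(i < m) turn_prob p M B (past ++ take i t) (tnth t i) = continue_prob past t.
  by rewrite -gen.
elim: m t past => [|m IH] t past; first by rewrite big_ord0 tuple0.
case/tupleP: t => x t; rewrite big_ord_recl /= cats0 -IH; congr (_ * _).
by apply: eq_bigr => i _; rewrite tnthS -cats1 -catA.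
Qed.

Lemma sum_tuple_cons m (F : history n -> R) :
  \sum_(t : m.+1.-tuple (turn n)) F t =
  \sum_x \sum_(t : m.-tuple (turn n)) F (x :: t).
Proof.
rewrite (pair_bigA _ (fun x (t : m.-tuple _) => F (x :: t))) /=.
rewrite (reindex (fun q : turn n * m.-tuple (turn n) => [tuple of q.1 :: q.2])) //=.
exists (fun t => (thead t, [tuple of behead t])) => [[x t] _|t _] /=.
  by congr (_, _); apply: val_inj.
by rewrite -tuple_eta.
Qed.

(** Backward induction: [V] is a submartingale under the two strategies and is at most the indicator
    of Maker's win at the end, so its initial value is at most his winning probability. *)
Lemma maker_win_prob_ge k (V : history n -> R) :
  (forall h, legal h -> (size h < N)%N ->
    V h <= p * (\sum_e M h e * V (rcons h (true, e))) +
           (1 - p) * (\sum_e B h e * V (rcons h (false, e)))) ->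
  (forall h, legal h -> size h = N -> V h <= (maker_wins k h)%:R) ->
  V [::] <= maker_win_prob p M B k.
Proof.
move=> Vsub Vend; rewrite /maker_win_prob big_mkcond /=.
(* Generalized to the winning probability conditioned on a legal past, with [m] turns to come. *)
suff gen m past : legal past -> (size past + m = N)%N -> V past <=
    \sum_(t : m.-tuple (turn n)) continue_prob past t * (maker_wins k (past ++ t))%:R.
  apply: le_trans (gen N [::] _ _) _ => //; rewrite le_eqVlt; apply/orP; left.
  apply/eqP/eq_bigr => h _; rewrite continue_probE.
  by case: (maker_wins _ _); rewrite ?mulr1 ?mulr0.
elim: m past => [|m IH] past lp sp.
  rewrite (big_pred1 [tuple]) => [|t]; last by apply/esym/eqP; apply: tuple0.
  by rewrite mul1r cats0 Vend // -[RHS]sp addn0.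
have sN : (size past < N)%N by rewrite -sp -ltn_subLR // subnn.
apply: le_trans (Vsub _ lp sN) _; rewrite -(sum_turn_prob past (fun x => V (rcons past x))).
rewrite (sum_tuple_cons _ (fun t => continue_prob past t *
  (maker_wins k (past ++ t))%:R)).
apply: ler_sum => x _ /=.
under eq_bigr do rewrite -mulrA.
(* Turns on a claimed edge have probability 0, so only legal continuations reach the induction
   hypothesis. *)
rewrite -mulr_sumr; have [xp|xp] := boolP (x.2 \in claimed past).
  by rewrite turn_prob_claimed // !mul0r.
apply: ler_wpM2l; first exact: turn_prob_ge0.
under eq_bigr do rewrite -cat_rcons.
by apply: IH; rewrite ?legal_rcons ?xp // size_rcons -sp addnS.
Qed.

End Game.

(** * Labels and dangers *)

Section Tracks.
Variables n k : nat.

(* The k parts are the integer intervals [j n / k, (j + 1) n / k). *)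
Definition part (v : nat) : nat := \sum_(1 <= i < k) (i * n <= k * v).

Lemma part_lt v : 0 < k -> part v < k.
Proof.
move=> k0; rewrite /part; apply: (@leq_ltn_trans (\sum_(1 <= i < k) 1)).
  by apply: leq_sum => i _; apply: leq_b1.
by rewrite sum_nat_const_nat; lia.
Qed.

Lemma part_eq v j : j < k -> j * n <= k * v < j.+1 * n -> part v = j.
Proof.
move=> jk /andP[l r]; rewrite /part (big_cat_nat (n := j.+1)) //=.
rewrite [X in _ + X]big_nat [X in _ + X]big1 ?addn0; last first.
  by move=> i /andP[? ?]; nia.
rewrite (eq_big_nat _ _ (F2 := fun=> 1)) ?sum_nat_const_nat; first by lia.
by move=> i /andP[? ?]; nia.
Qed.

Lemma card_part j : j < k -> n %/ k <= count (fun x => part x == j) (iota 0 n).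
Proof.
move=> jk; case: (posnP (n %/ k)) => [-> //|q0].
(* [c] is [j n / k] rounded up, the first vertex of the part, which then contains the [q]
   consecutive integers from [c] on. *)
pose c := (j * n + k.-1) %/ k; pose q := n %/ k.
have cE : j * n <= k * c /\ k * c < j * n + k.
  rewrite /c; have := divn_eq (j * n + k.-1) k.
  have : (j * n + k.-1) %% k < k by rewrite ltn_mod; lia.
  by nia.
have qE : k * q <= n by rewrite mulnC leq_divM.
have cq : c + q <= n.
  rewrite leqNgt; apply/negP => nc.
  have : k * n.+1 <= k * (c + q) by rewrite leq_mul2l nc orbT.
  have : j.+1 * n <= k * n by rewrite leq_mul2r jk orbT.
  by rewrite mulnS mulnDr mulSn; case: cE => ? ?; lia.
rewrite -/q -[X in iota 0 X](subnKC cq) -[c + q + _]addnA !iotaD !count_cat add0n.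
rewrite (_ : count _ (iota c q) = q); first by rewrite addnCA leq_addr.
rewrite -[RHS](size_iota c q); apply/eqP; rewrite -all_count; apply/allP => x.
rewrite mem_iota => /andP[cx xq]; apply/eqP; apply: part_eq => //.
have : k * c <= k * x by rewrite leq_mul2l cx orbT.
have : k * x.+1 <= k * (c + n %/ k) by rewrite leq_mul2l xq orbT.
by rewrite mulnS mulnDr -/q; case: cE => ? ?; lia.
Qed.

(* In track [j], [labels] partitions the part [j] into classes connected by
   Maker, each named after one of its vertices; a vertex outside the part is
   its own label until Maker joins it to the part. [claims v] counts Breaker's
   edges from [v] to the part. *)
Record track := Track { labels : nat -> nat; claims : nat -> nat }.

Definition src (x : turn n) : nat := (val x.2).1.
Definition tgt (x : turn n) : nat := (val x.2).2.

Definition merge (s : track) (u v : nat) : track :=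
  let: (dead, live) := if claims s (labels s u) <= claims s (labels s v)
    then (labels s v, labels s u) else (labels s u, labels s v) in
  Track (fun x => if labels s x == dead then live else labels s x) (claims s).

(** A vertex outside the part takes as label the vertex to which it is joined; all that matters
    later is that it is no longer its own label. Claims are kept for every vertex, so that a merge
    leaves them alone. *)
Definition track_step (j : nat) (s : track) (x : turn n) : track :=
  let u := src x in let v := tgt x in
  if x.1 then
    if part u == j then
      if part v == j then merge s u v
      else Track (fun y => if y == v then u else labels s y) (claims s)
    else if part v == j
      then Track (fun y => if y == u then v else labels s y) (claims s)
      else s
  else Track (labels s)
    (fun y => claims s y + ((y == u) && (part v == j)) + ((y == v) && (part u == j))).

Definition track_of (j : nat) (h : history n) : track :=
  foldl (track_step j) (Track id (fun=> 0)) h.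

Definition out (j : nat) (s : track) (v : nat) : nat :=
  count (fun x => (part x == j) && (labels s x != v)) (iota 0 n).

Definition active (j : nat) (s : track) (v : nat) : bool :=
  (labels s v == v) && (n <= 3 * k * out j s v).

Definition joins (u v : nat) (x : turn n) : bool :=
  (src x == u) && (tgt x == v) || (src x == v) && (tgt x == u).

Definition free (h : history n) (u v : nat) : bool := ~~ has (joins u v) h.

(** The pair is ordered: [v] supplies the label and [w] the track. The successor separates useful
    pairs, even of danger 0, from useless ones, which are chosen only when no useful pair is
    free. *)
Definition score (h : history n) (v w : nat) : nat :=
  let j := part w in let s := track_of j h in
  if active j s v && (labels s w != v) then (claims s v).+1 else 0.

Lemma track_rcons j h x : track_of j (rcons h x) = track_step j (track_of j h) x.
Proof. by rewrite /track_of foldl_rcons. Qed.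

Lemma src_lt x : src x < n. Proof. exact: ltn_ord. Qed.
Lemma tgt_lt x : tgt x < n. Proof. exact: ltn_ord. Qed.
Lemma src_tgt x : src x < tgt x. Proof. by case: x => b [[u v] p]. Qed.

Lemma mergeP s u v : exists2 p : nat * nat,
    p = (labels s u, labels s v) \/ p = (labels s v, labels s u) &
  (merge s u v = Track (fun x => if labels s x == p.1 then p.2 else labels s x)
     (claims s)) /\ claims s p.2 <= claims s p.1.
Proof.
rewrite /merge; case: leqP => c.
  by exists (labels s v, labels s u); [right|].
by exists (labels s u, labels s v); [left|split=> //; apply: ltnW].
Qed.

(** In a merge, [p] is the pair of the dying and the surviving label. The symmetry between the ends
    of the edge leaves three cases. *)
Variant maker_step_spec j s x : track -> Prop :=
| MakerMerge p of part (src x) = j & part (tgt x) = j &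
    p = (labels s (src x), labels s (tgt x)) \/
    p = (labels s (tgt x), labels s (src x)) & claims s p.2 <= claims s p.1 :
    maker_step_spec j s x (Track
      (fun y => if labels s y == p.1 then p.2 else labels s y) (claims s))
| MakerAttach u v of (u, v) = (src x, tgt x) \/ (u, v) = (tgt x, src x) &
    part u = j & part v != j :
    maker_step_spec j s x
      (Track (fun y => if y == v then u else labels s y) (claims s))
| MakerNone of part (src x) != j & part (tgt x) != j : maker_step_spec j s x s.

Lemma maker_stepP j s e :
  maker_step_spec j s (true, e) (track_step j s (true, e)).
Proof.
rewrite /track_step /=; case: eqP => [u|/eqP u]; case: eqP => [v|/eqP v].
- have [p pE [-> c]] := mergeP s (src (true, e)) (tgt (true, e)).
  exact: MakerMerge.
- by apply: MakerAttach => //; left.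
- by apply: MakerAttach => //; right.
- exact: MakerNone.
Qed.

(** * Invariants of a track *)

Definition linked j (h : history n) : rel 'I_n :=
  fun x y => [&& part x == j, part y == j & adjacent (maker_edges h) x y].

Lemma adjacent_sym (F : {set edge n}) : symmetric (adjacent F).
Proof. by move=> x y; apply: eq_existsb => e; rewrite orbC. Qed.

Lemma linked_sym j (h : history n) : symmetric (linked j h).
Proof. by move=> x y; rewrite /linked adjacent_sym andbCA. Qed.

Lemma adjacent_rcons (h : history n) t x y :
  adjacent (maker_edges h) x y -> adjacent (maker_edges (rcons h t)) x y.
Proof.
case/exists_inP => e; rewrite inE => eh exy; apply/exists_inP; exists e => //.
by rewrite inE mem_rcons inE eh orbT.
Qed.

Lemma connect_linked_rcons j (h : history n) t x y :
  connect (linked j h) x y -> connect (linked j (rcons h t)) x y.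
Proof.
apply: connect_sub => {x y} x y /and3P[px py a]; apply: connect1.
by rewrite /linked px py adjacent_rcons.
Qed.

Lemma adjacent_last (h : history n) e :
  adjacent (maker_edges (rcons h (true, e))) (val e).1 (val e).2.
Proof.
apply/exists_inP; exists e; first by rewrite inE mem_rcons mem_head.
by rewrite -surjective_pairing eqxx.
Qed.

(** [label_attached] and [label_connect] turn labels into paths of Maker. [label_maker] and
    [claims_count] account for the edges already claimed, so that counting yields a free one. *)
Record track_ok (j : nat) (h : history n) (s : track) : Prop := TrackOk {
  label_lt : forall x, x < n -> labels s x < n;
  label_part : forall x, part x = j -> part (labels s x) = j;
  label_idem : forall x, part x = j -> labels s (labels s x) = labels s x;
  label_attached : forall x : 'I_n, part x != j -> labels s x != x ->
    exists2 w : 'I_n, part w = j & adjacent (maker_edges h) x w;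
  label_connect : forall x y : 'I_n, part x = j -> part y = j ->
    labels s x = labels s y -> connect (linked j h) x y;
  label_maker : forall u v, has (fun x => x.1 && joins u v x) h -> part v = j ->
    if part u == j then labels s u = labels s v else labels s u <> u;
  claims_count : forall v,
    count (fun w => (part w == j) && has (fun x => ~~ x.1 && joins v w x) h)
      (iota 0 n) <= claims s v
}.

Lemma joinsP u v x : reflect ((u, v) = (src x, tgt x) \/ (v, u) = (src x, tgt x))
  (joins u v x).
Proof.
apply: (iffP orP) => -[]; first by case/andP=> /eqP<- /eqP<-; left.
- by case/andP=> /eqP<- /eqP<-; right.
- by case=> -> ->; left; rewrite !eqxx.
- by case=> -> ->; right; rewrite !eqxx.
Qed.

Lemma edge_ends u v : u < n -> v < n -> u != v ->
  exists e : edge n, forall b, joins u v (b, e).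
Proof.
move=> un vn; rewrite neq_ltn => /orP[] uv.
  exists (exist _ (Ordinal un, Ordinal vn) uv) => b.
  by rewrite /joins /src /tgt /= !eqxx.
exists (exist _ (Ordinal vn, Ordinal un) uv) => b.
by rewrite /joins /src /tgt /= !eqxx orbT.
Qed.

Lemma label_lt_step j s e : (forall x, x < n -> labels s x < n) ->
  forall x, x < n -> labels (track_step j s (true, e)) x < n.
Proof.
move=> L; have U := src_lt (true, e); have V := tgt_lt (true, e).
case: maker_stepP => [p _ _ pE _|u v uv _ _|_ _] //= x xn; case: eqP => // _;
  try exact: L.
- by case: pE => ->; apply: L.
- by case: uv => -[-> _].
Qed.

Lemma label_parts_step j s e :
  (forall x, part x = j -> part (labels s x) = j) ->
  forall x, part x = j -> part (labels (track_step j s (true, e)) x) = j.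
Proof.
move=> P; case: maker_stepP => [p pu pv pE _|u v uv pu _|_ _] //= x xj;
  case: eqP => // _; try exact: P.
by case: pE => -> /=; apply: P.
Qed.

Lemma label_idem_step j s e :
  (forall x, part x = j -> labels s (labels s x) = labels s x) ->
  (forall x, part x = j -> part (labels s x) = j) ->
  let s' := track_step j s (true, e) in
  forall x, part x = j -> labels s' (labels s' x) = labels s' x.
Proof.
move=> I P; case: maker_stepP => [p pu pv pE _|u v uv pu pv|_ _] //= x xj.
- have Ip : labels s p.2 = p.2 by case: pE => -> /=; apply: I.
  case: (labels s x =P p.1) => [_|ne]; first by rewrite Ip; case: eqP.
  by rewrite I // ifN //; apply/eqP.
- have xv : x == v = false by apply: contraNF pv => /eqP <-; apply/eqP.
  have lv : labels s x == v = false.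
    by apply: contraNF pv => /eqP <-; apply/eqP/P.
  by rewrite xv lv I.
Qed.

Lemma adjacent_ends (h : history n) e (x y : 'I_n) : joins x y (true, e) ->
  adjacent (maker_edges (rcons h (true, e))) x y.
Proof.
have := adjacent_last h e; rewrite /joins /src /tgt /= => A.
by case/orP=> /andP[/eqP/ord_inj <- /eqP/ord_inj <-] //; rewrite adjacent_sym.
Qed.

Lemma connect_linked_sym j h : connect_sym (linked j h).
Proof. exact/sym_connect_sym/linked_sym. Qed.

Lemma track_okP j h : track_ok j h (track_of j h).
Proof.
elim/last_ind: h => [|h x IH].
  split=> //=; first by move=> x _ /negP[].
    by move=> x y _ _ /ord_inj ->; apply: connect0.
  by move=> v; rewrite (eq_count (a2 := pred0)) ?count_pred0 // => w; rewrite andbF.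
rewrite track_rcons; case: IH.
set s := track_of j h => L P I A C M B; case: x => -[] e; last first.
  split=> //=.
  - by move=> x xj /(A x xj)[w wj a]; exists w => //; apply: adjacent_rcons.
  - by move=> x y xj yj /(C x y xj yj); apply: connect_linked_rcons.
  - by move=> u v; rewrite has_rcons /=; apply: M.
  - move=> v; rewrite /=; set e' := (false, e).
    pose D w := (part w == j) && joins v w e'.
    (* [D] holds at most the far end of Breaker's new edge, and only if that edge meets [v]; the two
       increments in [track_step], one for each orientation, pay for it. *)
    apply: (@leq_trans (claims s v + count D (iota 0 n))).
      apply: leq_trans (leq_add (B v) (leqnn _)); rewrite -count_predUI.
      apply: leq_trans (leq_addr _ _); apply: sub_count => w /=.
      by rewrite has_rcons /= /D -andb_orr orbC.
    rewrite -addnA leq_add2l.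
    have S a b : count (fun w => (v == a) && (part b == j) && (w == b)) (iota 0 n)
        <= (v == a) && (part b == j).
      case: andP => _; last by rewrite count_pred0.
      by rewrite count_uniq_mem ?iota_uniq ?leq_b1.
    apply: leq_trans (leq_add (S (src e') (tgt e')) (S (tgt e') (src e'))).
    rewrite -count_predUI; apply: leq_trans (leq_addr _ _); apply: sub_count => w /=.
    case/andP=> wj /joinsP[] [vE wE]; move: wj; rewrite vE wE => ->.
      by rewrite !eqxx.
    by rewrite !eqxx orbT.
split.
- exact: label_lt_step.
- exact: label_parts_step.
- exact: label_idem_step.
- have A' x : part (nat_of_ord x) != j -> labels s x != x ->
      exists2 w : 'I_n, part w = j & adjacent (maker_edges (rcons h (true, e))) x w.
    by move=> xj /(A x xj)[w wj a]; exists w => //; apply: adjacent_rcons.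
  case: maker_stepP => [p pu pv pE _|u v uv pu pv|_ _] //= x xj.
    case: (labels s x =P p.1) => [E|_]; last exact: A'.
    move=> ne; apply: A' => //; rewrite E; apply: contraNneq xj => <-; apply/eqP.
    by case: pE => ->; apply: P.
  case: (nat_of_ord x =P v) => [xv _|_]; last exact: A'.
  case: uv xv pu pv => -[-> ->] E pu pv.
    exists (val e).1 => //; apply: adjacent_ends; rewrite /joins E.
    by rewrite !eqxx orbT.
  by exists (val e).2 => //; apply: adjacent_ends; rewrite /joins E !eqxx.
- case: maker_stepP => [p pu pv pE _|u v uv pu pv|_ _] x y xj yj /=.
  + have link : connect (linked j (rcons h (true, e))) (val e).1 (val e).2.
      by apply: connect1; rewrite /linked adjacent_last andbT; apply/andP; split; apply/eqP.
    have C' a b : part (nat_of_ord a) = j -> part (nat_of_ord b) = j ->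
        labels s a = labels s b -> connect (linked j (rcons h (true, e))) a b.
      by move=> aj bj /(C a b aj bj); apply: connect_linked_rcons.
    have X a b : part (nat_of_ord a) = j -> part (nat_of_ord b) = j ->
        labels s a = p.1 -> labels s b = p.2 ->
        connect (linked j (rcons h (true, e))) a b.
      move=> aj bj; case: pE => -> /= aE bE.
        apply: connect_trans (connect_trans link _); last exact: C'.
        exact: C'.
      apply: (@connect_trans _ _ (val e).2); first exact: C'.
      apply: (@connect_trans _ _ (val e).1); last exact: C'.
      by rewrite connect_linked_sym.
    case: (labels s x =P p.1) => [xE|_]; case: (labels s y =P p.1) => [yE|_].
    * by move=> _; apply: C'; rewrite ?xE.
    * by move=> yE; apply: X.
    * by move=> yE'; rewrite connect_linked_sym; apply: X.
    * exact: C'.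
  + rewrite !ifN; [|by apply: contraNneq pv => <-; apply/eqP..].
    by move/(C x y xj yj); apply: connect_linked_rcons.
  + by move/(C x y xj yj); apply: connect_linked_rcons.
- move=> u v; rewrite has_rcons /= => uv vj.
  case: maker_stepP => [p pu pv pE _|a b ab pa pb|pa pb].
  + have E : joins u v (true, e) -> part u = j /\
        (labels s u = p.1 /\ labels s v = p.2 \/ labels s u = p.2 /\ labels s v = p.1).
      by case/joinsP=> -[-> ->]; case: pE => -> /=; split=> //; auto.
    case/orP: uv => [/E[-> H]|/M/(_ vj)]; rewrite /= ?eqxx.
      case: H => -[-> ->]; rewrite eqxx; case: eqP => // ->.
    (* A vertex outside the part cannot become its own label again, since the surviving label lies
       in the part. *)
    case: ifP => [_ -> //|uj ne]; case: eqP => // E1 E2.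
    by move: uj; rewrite -E2; case: pE => -> /=; rewrite P ?eqxx.
  + case/orP: uv => [uv|/M/(_ vj)].
      have [-> ->] : (v, u) = (a, b).
        by case/joinsP: uv ab vj pb => -[-> ->] [] [-> ->] // ->; rewrite eqxx.
      rewrite (negPf pb) /= eqxx => E; by rewrite -E pa eqxx in pb.
    have -> : labels (Track (fun y => if y == b then a else labels s y) (claims s)) v
        = labels s v.
      by rewrite /= ifN //; apply: contraNneq pb => <-; apply/eqP.
    case: ifP => [/eqP uj|uj] /=.
      by rewrite ifN //; apply: contraNneq pb => <-; apply/eqP.
    by case: eqP => // -> _ E; rewrite -E pa eqxx in pb.
  + case/orP: uv => [uv|/M/(_ vj) //].
    by case/joinsP: uv vj pa pb => -[-> ->] ->; rewrite eqxx.
- move=> v; have -> : claims (track_step j s (true, e)) = claims s.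
    by case: maker_stepP.
  apply: leq_trans (B v); apply: sub_count => w /=.
  by rewrite has_rcons.
Qed.

Lemma claims_maker j s e : claims (track_step j s (true, e)) = claims s.
Proof. by case: maker_stepP. Qed.

(** Maker only coarsens the classes: a dying label different from the survivor is itself relabelled,
    so it is no longer a fixed point, and an attachment changes no label inside the part. *)
Lemma maker_labels j h e v (s := track_of j h)
    (s' := track_step j s (true, e)) :
  labels s' v = v -> labels s v = v /\
    forall x, part x = j -> labels s x = v -> labels s' x = v.
Proof.
have [_ P I _ _ _ _] := track_okP j h; rewrite -/s in P I; rewrite {}/s'.
case: maker_stepP => [p pu pv pE _|a b ab pa pb|_ _] //=.
- have Ip : labels s p.2 = p.2 by case: pE => -> /=; apply: I.
  case: (labels s v =P p.1) => [vE E|ne E]; split; rewrite ?E //.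
  + by rewrite -E.
  + by move=> x xj ->; case: ifP.
  + by move=> x xj xv; rewrite xv; case: eqP => // E'; case: ne; rewrite E.
- case: (v =P b) => [vb E|_ E]; first by rewrite -vb -E pa eqxx in pb.
  split=> // x xj xv; case: eqP => // xb.
  by rewrite -xb xj eqxx in pb.
Qed.

Lemma active_maker j h e v (s := track_of j h) :
  active j (track_step j s (true, e)) v -> active j s v.
Proof.
case/andP=> /eqP/maker_labels[lv H] o; rewrite /active lv eqxx /=.
apply: leq_trans o _; rewrite leq_mul2l; apply/orP; right.
apply: sub_count => x /= /andP[/eqP xj]; rewrite xj eqxx.
by apply: contraNneq => xv; apply/eqP/H.
Qed.

(* Merging two classes of which one is not active gives a class which is not
   active, so that the more dangerous label ceases to be active in any case. *)
Lemma maker_kills j h e v w (s := track_of j h) :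
  w < n -> joins v w (true, e) -> part w = j -> active j s v -> labels s w != v ->
  (forall x, x < n -> active j s x -> claims s x <= claims s v) ->
  v < n -> exists x, [/\ x < n, active j s x, claims s x = claims s v &
    ~~ active j (track_step j s (true, e)) x].
Proof.
move=> wn vw wj av wv maxv vn; have /andP[/eqP lv _] := av.
have [L P I _ _ _ _] := track_okP j h; rewrite -/s in L P I.
case: maker_stepP => [p pu pv pE cp|a b ab pa pb|pu pv].
- have {pu pv pE} : p = (labels s w, labels s v) \/ p = (labels s v, labels s w).
    by case/joinsP: vw => -[-> ->]; case: pE; auto.
  rewrite lv => -[].
  + move=> pE; rewrite pE /= in cp *.
    have [aw|naw] := boolP (active j s (labels s w)).
      exists (labels s w); split=> //; first exact: L.
        by apply/eqP; rewrite eqn_leq cp maxv ?L.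
      by rewrite /active /= I // eqxx eq_sym (negPf wv).
    exists v; split=> //; apply: contra naw => /andP[_ o].
    rewrite /active I // eqxx /=; apply: leq_trans o _.
    rewrite leq_mul2l; apply/orP; right; apply: sub_count => x /= /andP[->].
    by case: (labels s x == labels s w); rewrite ?eqxx.
  + move=> pE; rewrite pE /=; exists v; split=> //.
    by rewrite /active /= lv eqxx (negPf wv).
- have [vb wa] : v = b /\ w = a.
    by case/joinsP: vw ab wj pb => -[-> ->] [] [-> ->] // ->; rewrite eqxx.
  exists v; split=> //; rewrite /active /= vb eqxx -wa.
  by apply: contraNN pb => /andP[/eqP <- _]; apply/eqP.
- by move: pu pv wj; case/joinsP: vw => -[-> ->] pu pv wj; rewrite wj eqxx in pu pv.
Qed.

(** At least [n / (3 k)] vertices of the part are outside the class of [v], more than Breaker has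
    joined to [v]. Maker has joined [v] to none of these, as his edge would have merged the labels,
    or attached [v] if it is outside the part. *)
Lemma active_free_edge j h v (s := track_of j h) :
  active j s v -> 3 * k * claims s v < n ->
  exists w, [/\ w < n, part w = j, free h v w & labels s w != v].
Proof.
case/andP=> /eqP lv o b; have [_ _ _ _ _ M B] := track_okP j h.
rewrite -/s in M B.
pose O w := (part w == j) && (labels s w != v).
pose Br w := (part w == j) && has (fun x => ~~ x.1 && joins v w x) h.
have : ~~ all (fun w => O w ==> Br w) (iota 0 n).
  apply/negP => /allP H; have : out j s v <= claims s v.
    apply: leq_trans (B v); rewrite /out (@eq_in_count _ _ (predI O Br)).
      by apply: sub_count => w /andP[].
    by move=> w /H /=; rewrite -/(O w); case: (O w).
  by nia.
case/allPn => w; rewrite mem_iota /= add0n negb_imply => wn /andP[/andP[/eqP wj wv]].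
rewrite /Br wj eqxx /= => nb; exists w; split=> //.
apply/hasPn => x xh; apply/negP => vw.
have [x1|x1] := boolP x.1; last first.
  by case/negP: nb; apply/hasP; exists x => //; rewrite x1.
have : has (fun x => x.1 && joins v w x) h by apply/hasP; exists x; rewrite ?x1.
by move/M/(_ wj); rewrite lv; case: ifP => // _ E; rewrite -E eqxx in wv.
Qed.

(** Some part avoids the deleted set. Without active labels that part is a single class, hence
    connected by Maker, and each vertex outside it has a neighbour in it. *)
Lemma inactive_connected (h : history n) : 0 < k -> 3 * k <= n ->
  (forall j v, j < k -> v < n -> ~~ active j (track_of j h) v) ->
  k_connected k (maker_edges h).
Proof.
move=> k0 kn inact; apply/andP; split; first by lia.
apply/forallP => X; apply/implyP => Xk.
have [j jX] : exists j : 'I_k, forall x : 'I_n, part x = j -> x \notin X.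
  have /existsP[j /forallP H] : [exists j : 'I_k, [forall x in X, part x != j]].
    apply: contraTT Xk; rewrite negb_exists -leqNgt => /forallP H.
    pose f (x : 'I_n) := Ordinal (part_lt x k0).
    rewrite -[X in X <= _](card_ord k) -cardsT.
    apply: leq_trans (leq_imset_card f X); apply/subset_leq_card/fintype.subsetP => j _.
    move: (H j); rewrite negb_forall_in => /exists_inP[x xX /negPn/eqP xj].
    by apply/imsetP; exists x => //; apply: val_inj.
  exists j => x xj; apply/negP => xX.
  by have /implyP/(_ xX) := H x; rewrite xj eqxx.
have [L P I A C _ _] := track_okP j h; set s := track_of j h in L P I A C.
pose E := [rel x y | [&& x \notin X, y \notin X & adjacent (maker_edges h) x y]].
have Esym : connect_sym E.
  by apply: sym_connect_sym => x y /=; rewrite adjacent_sym andbCA.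
have out_small x : x < n -> labels s x = x -> 3 * k * out j s x < n.
  by move=> xn lx; have := inact j x (ltn_ord j) xn; rewrite /active lx eqxx -ltnNge.
have cardj := card_part (ltn_ord j).
have nk : n < k * (n %/ k).+1 by rewrite mulnC ltn_ceil.
(* Every vertex of the part is outside one of two distinct classes, so their out-counts would add up
   to at least [n %/ k], whereas both are below [n / (3 k)]. *)
have single x y : x < n -> y < n -> part x = j -> part y = j ->
    labels s x = labels s y.
  move=> xn yn xj yj; apply/eqP/negPn/negP => ne.
  have ox := out_small _ (L x xn) (I x xj).
  have oy := out_small _ (L y yn) (I y yj).
  have : n %/ k <= out j s (labels s x) + out j s (labels s y).
    apply: leq_trans cardj _; rewrite -count_predUI.
    apply: leq_trans (leq_addr _ _); apply: sub_count => z /= ->.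
    by case: eqP => //= ->; rewrite ne.
  by nia.
have inside (x y : 'I_n) : part x = j -> part y = j -> connect E x y.
  move=> xj yj; have := C x y xj yj (single _ _ (ltn_ord x) (ltn_ord y) xj yj).
  apply: connect_sub => a b /and3P[/eqP aj /eqP bj ab]; apply: connect1 => /=.
  by rewrite ab !jX.
(* A vertex outside the part that is still its own label has the whole part in its out-count and
   would be active. *)
have reach (x : 'I_n) : x \notin X -> exists2 w : 'I_n, part w = j & connect E x w.
  move=> xX; have [/eqP xj|xj] := boolP (part x == j); first by exists x.
  have /A[] // : labels s x != x.
    apply/eqP => lx; have := out_small x (ltn_ord x) lx.
    suff : n %/ k <= out j s x by nia.
    apply: leq_trans cardj _; apply: sub_count => z /= /eqP zj; rewrite zj eqxx /=.
    by apply: contraNneq xj => <-; apply/eqP/P.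
  by move=> w wj a; exists w => //; apply: connect1; rewrite /= xX a jX.
apply/forall_inP => u; rewrite inE => /reach[u' uj uu'].
apply/forall_inP => v; rewrite inE => /reach[v' vj vv'].
apply: connect_trans uu' _; apply: connect_trans (inside _ _ uj vj) _.
by rewrite Esym.
Qed.

End Tracks.

(** * The potential *)

Section Potential.
Local Open Scope ring_scope.
Variables (R : realFieldType) (n k : nat) (p : R).
Hypothesis p01 : 0 <= p <= 1.

Let lam : R := 1 + p / 2.
(** Scaled to reach 1 at danger [n %/ (3 * k)], beyond which an active label may have no useful free
    edge left. *)
Let weight (c : nat) : R := lam ^+ c / lam ^+ (n %/ (3 * k)).
Let live (h : history n) (q : 'I_k * 'I_n) : bool :=
  active n k q.1 (track_of k q.1 h) q.2.
Let danger (h : history n) (q : 'I_k * 'I_n) : nat :=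
  claims (track_of k q.1 h) q.2.

Definition potential (h : history n) : R :=
  \sum_(q : 'I_k * 'I_n) (live h q)%:R * weight (danger h q).

Lemma lam_ge1 : 1 <= lam.
Proof. by case/andP: p01 => p0 _; rewrite /lam; lra. Qed.

Lemma lam_gt0 : 0 < lam.
Proof. exact: lt_le_trans ltr01 lam_ge1. Qed.

Lemma weight_ge0 c : 0 <= weight c.
Proof. by rewrite divr_ge0 // exprn_ge0 // ltW // lam_gt0. Qed.

Lemma weight_le a b : (a <= b)%N -> weight a <= weight b.
Proof.
move=> ab; rewrite ler_wpM2r ?invr_ge0 ?exprn_ge0 ?(ltW lam_gt0) //.
by rewrite ler_weXn2l // lam_ge1.
Qed.

Lemma weightS c : weight c.+1 = weight c + p / 2 * weight c.
Proof. by rewrite /weight exprS /lam; ring. Qed.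

Lemma potential_ge0 h : 0 <= potential h.
Proof. by apply: sumr_ge0 => q _; rewrite mulr_ge0 ?weight_ge0. Qed.

Lemma potential_start : potential [::] <= (n * k)%:R * weight 0.
Proof.
apply: (@le_trans _ _ (\sum_(q : 'I_k * 'I_n) weight 0)).
  apply: ler_sum => q _; rewrite ler_piMl ?weight_ge0 //.
  by rewrite lern1 leq_b1.
by rewrite sumr_const card_prod !card_ord mulr_natl mulnC.
Qed.

Lemma potential_ge1 h q : live h q -> (n <= 3 * k * danger h q)%N ->
  1 <= potential h.
Proof.
move=> lq nq; rewrite /potential (bigD1 q) //= lq mul1r -[X in X <= _]addr0 lerD //.
  rewrite ler_pdivlMr ?exprn_gt0 ?lam_gt0 // mul1r ler_weXn2l ?lam_ge1 //.
  have k0 : (0 < 3 * k)%N by case: q {lq nq} => -[a ak] _; lia.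
  by rewrite -(mulKn (danger h q) k0) leq_div2r.
by apply: sumr_ge0 => ? _; rewrite mulr_ge0 ?weight_ge0 ?ler0n.
Qed.

Lemma live_maker h e q : live (rcons h (true, e)) q -> live h q.
Proof. by rewrite /live track_rcons; apply: active_maker. Qed.

Lemma danger_maker h e q : danger (rcons h (true, e)) q = danger h q.
Proof. by rewrite /danger track_rcons claims_maker. Qed.

Lemma live_breaker h e q : live (rcons h (false, e)) q = live h q.
Proof. by rewrite /live track_rcons. Qed.

(** The edge [uv] raises only the danger of [u] in the track of [v] and of [v] in the track of [u].
    Each increment multiplies a weight by [1 + p / 2], so it adds at most [p / 2] times the largest
    weight. *)
Lemma potential_breaker h e c :
  (forall q, live h q -> (danger h q <= c)%N) ->
  potential (rcons h (false, e)) <= potential h + p * weight c.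
Proof.
case/andP: p01 => p0 _ dc.
pose u := (val e).1; pose v := (val e).2.
pose hit (q : 'I_k * 'I_n) : nat :=
  (((q.2 == u) && (part n k v == q.1)) + ((q.2 == v) && (part n k u == q.1)))%N.
have uv : u != v by rewrite neq_ltn (valP e).
have hit_le1 q : (hit q <= 1)%N.
  by rewrite /hit; case: (eqVneq q.2 u) => [->|]; rewrite ?(negPf uv) /= ?addn0 ?leq_b1.
have dangerE q : danger (rcons h (false, e)) q = (danger h q + hit q)%N.
  by rewrite /danger track_rcons /hit /track_step /= addnA.
have sum_hit : (\sum_q hit q <= 2)%N.
  have S a b : (\sum_(q : 'I_k * 'I_n) ((q.2 == a) && (part n k b == q.1)) <= 1)%N.
    rewrite -big_mkcond sum1_card; apply/card_le1_eqP => -[j x] [j' x'] /=.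
    move=> /andP[/= /eqP -> /eqP bj] /andP[/= /eqP -> /eqP bj'].
    by congr (_, _); apply: val_inj; rewrite /= -bj -bj'.
  by rewrite big_split /=; apply: leq_add (S u v) (S v u).
have pw0 : 0 <= p / 2 * weight c by rewrite mulr_ge0 ?weight_ge0 ?divr_ge0 ?ler0n.
apply: (@le_trans _ _ (potential h + \sum_q p / 2 * weight c * (hit q)%:R)).
  rewrite -big_split /=; apply: ler_sum => q _; rewrite live_breaker dangerE.
  have [lq|_] := boolP (live h q); last first.
    by rewrite !mul0r add0r mulr_ge0 ?pw0.
  rewrite !mul1r; case: (hit q) (hit_le1 q) => [|[|//]] _.
    by rewrite addn0 mulr0 addr0.
  rewrite addn1 weightS mulr1 lerD2l ler_wpM2l ?divr_ge0 ?ler0n //.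
  exact/weight_le/dc.
rewrite lerD2l -mulr_sumr -natr_sum.
have -> : p * weight c = p / 2 * weight c * 2 by field.
by rewrite ler_wpM2l ?ler_nat.
Qed.

Definition best_move (h : history n) (e : edge n) : Prop :=
  exists v w, [/\ (v < n)%N, (w < n)%N, joins v w (true, e), free h v w &
    forall v' w', (v' < n)%N -> (w' < n)%N -> v' != w' -> free h v' w' ->
      (score k h v' w' <= score k h v w)%N].

(** The witness [c] is the largest danger of a live label; Maker's move makes some label of that
    danger inactive and revives none. *)
Lemma potential_maker h e : (0 < k)%N -> best_move h e ->
  (exists q, live h q) ->
  (forall q, live h q -> (3 * k * danger h q < n)%N) ->
  exists c, (forall q, live h q -> (danger h q <= c)%N) /\
    potential (rcons h (true, e)) <= potential h - weight c.
Proof.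
move=> k0 [v [w [vn wn vw fvw best]]] [q0 lq0] safe.
(* Each live label still has a useful free edge, against which the chosen move was compared. *)
have score_live q : live h q -> (danger h q < score k h v w)%N.
  move=> lq; have [w' [wn' wj' fw' wq']] := active_free_edge lq (safe q lq).
  have /andP[/eqP lqq _] := lq.
  have := best q.2 w' (ltn_ord _) wn' _ fw'; rewrite /score wj'.
  rewrite -/(live h q) lq wq' /=; apply.
  by apply: contraNneq wq' => <-; apply/eqP.
(* As some label is live, the best score is positive, so [v] is active in the track of [w] and the
   classes differ. *)
have := score_live _ lq0; rewrite {1}/score; case: ifP => // /andP[av wv] _.
set j := part n k w in av wv; pose q1 := (Ordinal (part_lt n w k0), Ordinal vn).
have lq1 : live h q1 by [].
exists (danger h q1); have max_q1 q : live h q -> (danger h q <= danger h q1)%N.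
  by move/score_live; rewrite /score av wv.
split=> //.
have [|x [xn ax cx nx]] := maker_kills wn vw erefl av wv _ vn.
  by move=> x xn ax; apply: (max_q1 (Ordinal (part_lt n w k0), Ordinal xn)).
pose q := (Ordinal (part_lt n w k0), Ordinal xn) : 'I_k * 'I_n.
rewrite /potential (bigD1 q) //= [X in _ <= X - _](bigD1 q) //=.
have -> : live (rcons h (true, e)) q = false.
  by apply: contraNF nx; rewrite /live track_rcons.
have -> : live h q by [].
have -> : danger h q = danger h q1 by [].
rewrite mul0r add0r mul1r addrAC subrr add0r; apply: ler_sum => q' _.
rewrite danger_maker ler_wpM2r ?weight_ge0 // ler_nat.
by have [/live_maker ->|] := boolP (live (rcons h (true, e)) q').
Qed.

(** Truncated at 0 because the drift of the potential is controlled only while all live dangers are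
    below the threshold; past it the potential is at least 1 and nothing has to be shown. *)
Definition safety (h : history n) : R := Num.max 0 (1 - potential h).

(** With [c] the largest live weight, Maker's turn gains [c] with probability [p], and Breaker's
    turn costs at most [p c] with probability [1 - p]. *)
Lemma safety_submartingale (M B : strategy R n) h e0 :
  (0 < k)%N -> legal h -> (size h < #|{: edge n}|)%N ->
  (forall e, M h e = (e == e0)%:R) -> best_move h e0 ->
  safety h <= p * (\sum_e M h e * safety (rcons h (true, e))) +
              (1 - p) * (\sum_e B h e * safety (rcons h (false, e))).
Proof.
move=> k0 lh sh Mf best; set V := safety; case/andP: (p01) => p0 p1.
have [B0 _ B1] := strategyP B lh sh.
have -> : \sum_e M h e * V (rcons h (true, e)) = V (rcons h (true, e0)).
  rewrite (bigD1 e0) //= Mf eqxx mul1r big1 ?addr0 // => e ne.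
  by rewrite Mf (negPf ne) mul0r.
have V0 h' : 0 <= V h' by rewrite /V /safety le_max lexx.
have Vge h' : 1 - potential h' <= V h' by rewrite /V /safety le_max lexx orbT.
rewrite {1}/V /safety ge_max; apply/andP; split.
  rewrite addr_ge0 ?mulr_ge0 ?subr_ge0 //; apply: sumr_ge0 => e _.
  by rewrite mulr_ge0.
have [|safe] := boolP [exists q, live h q && (n <= 3 * k * danger h q)%N].
  case/existsP=> q /andP[lq /(potential_ge1 lq) bad].
  apply: (@le_trans _ _ 0); first by rewrite subr_le0.
  rewrite addr_ge0 ?mulr_ge0 ?subr_ge0 //; apply: sumr_ge0 => e _.
  by rewrite mulr_ge0.
have {safe} safe q : live h q -> (3 * k * danger h q < n)%N.
  move=> lq; move: safe; rewrite negb_exists => /forallP/(_ q).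
  by rewrite lq /= -ltnNge.
suff [c [c0 cM cB]] : exists c, [/\ 0 <= c,
    potential (rcons h (true, e0)) <= potential h - c &
    forall e, potential (rcons h (false, e)) <= potential h + p * c].
  (* The middle expression is [1 - potential h + p ^ 2 c]. *)
  apply: (@le_trans _ _ (p * (1 - potential h + c) + (1 - p) * (1 - potential h - p * c))).
    have : 0 <= p * (p * c) by rewrite mulr_ge0 ?mulr_ge0.
    by set X := potential h; lra.
  apply: lerD; apply: ler_wpM2l; rewrite ?subr_ge0 //.
    by apply: le_trans (Vge _); lra.
  rewrite -[X in X <= _]mul1r -B1 mulr_suml; apply: ler_sum => e _.
  by rewrite ler_wpM2l //; apply: le_trans (Vge _); have := cB e; lra.
have [/existsP ex|none] := boolP [exists q, live h q].
  have [c [maxc cM]] := potential_maker k0 best ex safe.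
  by exists (weight c); split=> // [|e]; [exact: weight_ge0|exact: potential_breaker].
have {}none q : live h q = false.
  by apply: contraNF none => lq; apply/existsP; exists q.
(* With no live label the potential is 0 for good, as no move creates a live label. *)
exists 0; rewrite subr0 mulr0 addr0; split=> // [|e]; apply: ler_sum => q _.
  by rewrite none; case: (boolP (live _ _)) => [/live_maker|_]; rewrite ?none ?mul0r.
by rewrite live_breaker none !mul0r.
Qed.

(** An active label would have danger below the threshold, hence a free edge, but every edge is
    claimed. *)
Lemma inactive_of_potential h : legal h -> size h = #|{: edge n}| ->
  potential h < 1 -> forall j v, (j < k)%N -> (v < n)%N ->
  ~~ active n k j (track_of k j h) v.
Proof.
move=> lh sh X1 j v jk vn; apply/negP => av.
pose q := (Ordinal jk, Ordinal vn) : 'I_k * 'I_n.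
have [|nq] := leqP n (3 * k * danger h q).
  by move/(@potential_ge1 h q av)/(lt_le_trans X1); rewrite ltxx.
have [w [wn _ fr]] := active_free_edge av nq.
have full e : e \in claimed h.
  have : claimed h =i mem {: edge n}.
    apply/subset_cardP; last by apply/fintype.subsetP.
    by rewrite (card_uniqP lh) /claimed size_map sh; apply: eq_card.
  by move=> ->.
move=> lw; have vw : v != w.
  by apply: contraNneq lw => <-; case/andP: av.
have [e vwe] := edge_ends vn wn vw.
have /mapP[x xh ex] := full e; case/negP: fr; apply/hasP; exists x => //.
by have := vwe x.1; rewrite ex -surjective_pairing.
Qed.
End Potential.

(** * Programs with a time bound *)

(* A command of level [l] runs in time [n ^ l] when all its loops are bounded
   by [n ^ 2]. *)
Fixpoint level (c : cmd) : nat :=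
  match c with
  | Skip | Assign _ _ | Toss _ => 1
  | Seq c1 c2 | If _ c1 c2 => (maxn (level c1) (level c2)).+1
  | While _ c1 => level c1 + 3
  end.

Definition for_loop (i : nat) (e : expr) (c : cmd) : cmd :=
  Seq (Assign (Const i) (Const 0))
    (While (Minus e (Mem (Const i)))
      (Seq c (Assign (Const i) (Plus (Mem (Const i)) (Const 1))))).

Section Logic.
Variables (inp : seq nat) (n : nat).
Hypothesis n4 : 4 <= n.

(** Total correctness with a time bound, in continuation style: the command runs in front of any
    [cs], and it leaves the random bits [w] untouched because Maker's program never tosses. *)
Definition achieves (c : cmd) (m : memory) (Q : memory -> Prop) : Prop :=
  exists t m', [/\ t <= n ^ level c,
    forall cs w, iter t (step inp) (Config (c :: cs) m w) = Config cs m' w & Q m'].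

Let n0 : 0 < n. Proof. exact: leq_trans n4. Qed.

Lemma achieves_skip m (Q : memory -> Prop) : Q m -> achieves Skip m Q.
Proof. by move=> q; exists 1, m; rewrite expn1. Qed.

Lemma achieves_assign e1 e2 m (Q : memory -> Prop) :
  Q (write m (eval inp m e1) (eval inp m e2)) -> achieves (Assign e1 e2) m Q.
Proof. by move=> q; exists 1, (write m (eval inp m e1) (eval inp m e2)); rewrite expn1. Qed.

(** The inequality is strict to pay for the step that unfolds a sequence or a conditional. *)
Lemma expn_level2 a b : n ^ a + n ^ b < n ^ (maxn a b).+1.
Proof.
have la : n ^ a <= n ^ maxn a b by rewrite leq_pexp2l ?leq_maxl.
have lb : n ^ b <= n ^ maxn a b by rewrite leq_pexp2l ?leq_maxr.
have : 0 < n ^ maxn a b by rewrite expn_gt0 n0.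
by rewrite expnS; nia.
Qed.

Lemma achieves_seq c1 c2 m Q :
  achieves c1 m (fun m1 => achieves c2 m1 Q) -> achieves (Seq c1 c2) m Q.
Proof.
case=> t1 [m1 [l1 r1 [t2 [m2 [l2 r2 q]]]]].
exists (t2 + t1).+1, m2; split=> // [|cs w].
  by apply: leq_ltn_trans (expn_level2 _ _); rewrite addnC leq_add.
by rewrite iterSr iterD /= r1 r2.
Qed.

Lemma achieves_if e c1 c2 m Q :
  achieves (if eval inp m e != 0 then c1 else c2) m Q -> achieves (If e c1 c2) m Q.
Proof.
case=> t [m' [l r q]]; exists t.+1, m'; split=> // [|cs w].
  apply: leq_ltn_trans (expn_level2 _ _); apply: leq_trans l _.
  by case: ifP => _; rewrite ?leq_addr ?leq_addl.
by rewrite iterSr /= r.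
Qed.

Lemma achieves_weaken c m (Q Q' : memory -> Prop) :
  achieves c m Q -> (forall m', Q m' -> Q' m') -> achieves c m Q'.
Proof. by case=> t [m' [l r q]] H; exists t, m'; split=> //; apply: H. Qed.

(** [Inv a] holds when the counter shows [a]. The bound [e] must have the value [N] in every memory,
    so it has to be a constant or part of the input. *)
Lemma achieves_for i e c m N (Inv : nat -> memory -> Prop) (Q : memory -> Prop) :
  (forall m', eval inp m' e = N) -> N <= n ^ 2 ->
  Inv 0 (write m i 0) ->
  (forall a m', a < N -> m' i = a -> Inv a m' ->
    achieves c m' (fun m'' => m'' i = a /\ Inv a.+1 (write m'' i a.+1))) ->
  (forall m', Inv N m' -> Q m') ->
  achieves (for_loop i e c) m Q.
Proof.
move=> eN Nn I0 step_ok IQ; apply/achieves_seq/achieves_assign => /=.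
set body := Seq c _; pose L := n ^ level body.
(* Induction on the number [d] of remaining rounds; a round costs the body and one test. *)
have loop d : d <= N -> forall m', m' i = N - d -> Inv (N - d) m' ->
  exists t m'', [/\ t <= d * L.+1 + 1, forall cs w,
    iter t (step inp) (Config (While (Minus e (Mem (Const i))) body :: cs) m' w)
      = Config cs m'' w & Inv N m''].
  elim: d => [|d IH] dN m' mi I.
    exists 1, m'; split=> // [cs w|]; last by rewrite subn0 in I.
    by rewrite /= eN mi subn0 subnn.
  have aN : N - d.+1 < N by lia.
  have : achieves body m' (fun m'' => m'' i = N - d /\ Inv (N - d) m'').
    apply: achieves_seq; apply: (achieves_weaken (step_ok _ _ aN mi I)) => m'' [mi'' I''].
    apply: achieves_assign => /=; rewrite mi'' addn1 -subSn // subSS in I'' *.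
    by rewrite {1}/write eqxx.
  case=> t1 [m1 [l1 r1 [mi1 I1]]].
  have [t2 [m2 [l2 r2 I2]]] := IH (ltnW dN) m1 mi1 I1.
  exists (t2 + t1).+1, m2; split=> // [|cs w]; first by rewrite mulSn /L; lia.
  by rewrite iterSr iterD /= eN mi subn_eq0 -ltnNge aN r1 r2.
have [] := loop N (leqnn N) (write m i 0) _ _; rewrite ?subnn //.
  by rewrite /write eqxx.
move=> t [m' [l r I]]; exists t, m'; split=> //; last exact: IQ.
(* The time is at most [n^2 (L + 1) + 1 <= 4 n^2 L <= n^3 L], which is where [4 <= n] is needed. *)
apply: leq_trans l _; rewrite [level _](_ : _ = level body + 3) // expnD -/L.
have : 0 < L by rewrite expn_gt0 n0.
move: Nn; rewrite expnS expn1 => Nn L0.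
have : N * L.+1 <= n * n * (2 * L) by apply: leq_mul => //; lia.
have : 1 <= n * n * L by rewrite !muln_gt0 n0 L0.
have : 4 * (n * n * L) <= n * (n * n * L) by rewrite leq_mul2r n4 orbT.
by rewrite (_ : n * (n * n * L) = L * n ^ 3); last ring; lia.
Qed.

End Logic.

(** * Comparisons and connectives from truncated subtraction *)

Definition cell (c : nat) : expr := Mem (Const c).
Definition not_e (a : expr) : expr := Minus (Const 1) a.
Definition le_e (a b : expr) : expr := not_e (Minus a b).
Definition eq_e (a b : expr) : expr := not_e (Plus (Minus a b) (Minus b a)).
Definition and_e (a b : expr) : expr := not_e (Plus (not_e a) (not_e b)).
Definition mul_e (c : nat) (e : expr) : expr := iter c (Plus e) (Const 0).

Section Expressions.
Variables (inp : seq nat) (m : memory).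
Local Notation ev := (eval inp m).

Lemma eval_le a b : ev (le_e a b) = (ev a <= ev b).
Proof. by rewrite /=; lia. Qed.

Lemma eval_le_neq0 a b : (ev (le_e a b) != 0) = (ev a <= ev b).
Proof. by rewrite eval_le; case: leqP. Qed.

Lemma eval_eq a b : (ev (eq_e a b) != 0) = (ev a == ev b).
Proof. by rewrite /=; lia. Qed.

Lemma eval_neq a b : (ev (not_e (eq_e a b)) != 0) = (ev a != ev b).
Proof. by rewrite /=; lia. Qed.

Lemma eval_and a b : (ev (and_e a b) != 0) = (ev a != 0) && (ev b != 0).
Proof. by rewrite /=; lia. Qed.

Lemma eval_or a b : (ev (Plus a b) != 0) = (ev a != 0) || (ev b != 0).
Proof. by rewrite /=; lia. Qed.

Lemma eval_lt a b : (ev (Minus b a) != 0) = (ev a < ev b).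
Proof. by rewrite /=; lia. Qed.

Lemma eval_mul c e : ev (mul_e c e) = c * ev e.
Proof. by elim: c => //= c ->; rewrite mulSn. Qed.
End Expressions.

Lemma write_neq m a x b : b != a -> write m a x b = m b.
Proof. by rewrite /write => /negPf ->. Qed.

Definition same_but (l : seq nat) (m m' : memory) : Prop :=
  forall c, c \notin l -> m' c = m c.

Lemma same_but_write l m m' a x : a \in l -> same_but l m m' ->
  same_but l m (write m' a x).
Proof.
move=> al sm c cl; rewrite write_neq ?sm //.
by apply: contraNneq cl => ->.
Qed.

Lemma same_but_trans l l' m m' m'' : {subset l' <= l} ->
  same_but l m m' -> same_but l' m' m'' -> same_but l m m''.
Proof.
move=> sub s1 s2 c cl; rewrite s2 ?s1 //.
by apply: contraNN cl; apply: sub.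
Qed.

(** * The program computing Maker's move *)

Section Program.
Variable k : nat.

(* Memory layout.
     0, 1    the best edge found so far
     2       the track
     3, 4    the vertices v, w of the candidate edge
     5, 6    counters running over the history and over the vertices
     8, 9    the dead and the surviving label of a merge
     10      1 + score of the best edge, 0 if there is none yet
     11      whether the candidate edge is free
     12      out-count of v
     13      1 + score of the candidate edge
   The label and the claims of the vertex x are in the cells 20 + 2 x and
   21 + 2 x. *)
Definition lab_cell (e : expr) : expr := Plus (Const 20) (Plus e e).
Definition claims_cell (e : expr) : expr := Plus (Const 21) (Plus e e).
Definition lab_e (e : expr) : expr := Mem (lab_cell e).
Definition claims_e (e : expr) : expr := Mem (claims_cell e).

Definition n_e : expr := Input (Const 0).
Definition size_e : expr := Input (Const 1).
(** Field [c] of the turn counted by cell 5: the input starts with two header entries, followed by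
    three numbers per turn. *)
Definition turn_e (c : nat) : expr :=
  Input (Plus (Const (2 + c)) (mul_e 3 (cell 5))).

Definition part_e (e : expr) : expr :=
  foldr (fun i acc => Plus (le_e (mul_e i n_e) (mul_e k e)) acc) (Const 0)
    (index_iota 1 k).
Definition in_part_e (e : expr) : expr := eq_e (part_e e) (cell 2).

Definition init_cmd : cmd :=
  for_loop 6 n_e (Seq (Assign (lab_cell (cell 6)) (cell 6))
                      (Assign (claims_cell (cell 6)) (Const 0))).

(** Both labels are saved first, since the relabelling loop overwrites the cells from which they are
    read. *)
Definition merge_cmd (u v : expr) : cmd :=
  Seq (If (le_e (claims_e (lab_e u)) (claims_e (lab_e v)))
        (Seq (Assign (Const 8) (lab_e v)) (Assign (Const 9) (lab_e u)))
        (Seq (Assign (Const 8) (lab_e u)) (Assign (Const 9) (lab_e v))))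
      (for_loop 6 n_e
        (If (eq_e (lab_e (cell 6)) (cell 8))
          (Assign (lab_cell (cell 6)) (cell 9)) Skip)).

Definition incr_cmd (e : expr) : cmd :=
  Assign (claims_cell e) (Plus (claims_e e) (Const 1)).

Definition turn_cmd : cmd :=
  let u := turn_e 1 in let v := turn_e 2 in
  If (turn_e 0)
    (If (in_part_e u)
      (If (in_part_e v) (merge_cmd u v) (Assign (lab_cell v) u))
      (If (in_part_e v) (Assign (lab_cell u) v) Skip))
    (Seq (If (in_part_e v) (incr_cmd u) Skip) (If (in_part_e u) (incr_cmd v) Skip)).

Definition free_cmd : cmd :=
  Seq (Assign (Const 11) (Const 1))
    (for_loop 5 size_e
      (If (Plus (and_e (eq_e (turn_e 1) (cell 3)) (eq_e (turn_e 2) (cell 4)))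
                (and_e (eq_e (turn_e 1) (cell 4)) (eq_e (turn_e 2) (cell 3))))
        (Assign (Const 11) (Const 0)) Skip)).

Definition out_cmd : cmd :=
  Seq (Assign (Const 12) (Const 0))
    (for_loop 6 n_e
      (If (and_e (in_part_e (cell 6)) (not_e (eq_e (lab_e (cell 6)) (cell 3))))
        (Assign (Const 12) (Plus (cell 12) (Const 1))) Skip)).

Definition score_cmd : cmd :=
  If (and_e (and_e (eq_e (lab_e (cell 3)) (cell 3))
                   (le_e n_e (mul_e (3 * k) (cell 12))))
            (not_e (eq_e (lab_e (cell 4)) (cell 3))))
    (Assign (Const 13) (Plus (claims_e (cell 3)) (Const 2)))
    (Assign (Const 13) (Const 1)).

(** The nested truncated subtractions are the minimum and the maximum of [v] and [w], so the edge is
    stored with its smaller end first. *)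
Definition update_cmd : cmd :=
  If (Minus (cell 13) (cell 10))
    (Seq (Assign (Const 10) (cell 13))
      (Seq (Assign (Const 0) (Minus (cell 3) (Minus (cell 3) (cell 4))))
           (Assign (Const 1) (Plus (cell 3) (Minus (cell 4) (cell 3))))))
    Skip.

Definition consider_cmd : cmd :=
  If (and_e (in_part_e (cell 4)) (not_e (eq_e (cell 3) (cell 4))))
    (Seq free_cmd
      (If (cell 11) (Seq out_cmd (Seq score_cmd update_cmd)) Skip))
    Skip.

(** One track is in memory at a time: for each part the whole history is replayed, and only the best
    edge is carried over. *)
Definition move_cmd : cmd :=
  for_loop 2 (Const k)
    (Seq init_cmd (Seq (for_loop 5 size_e turn_cmd)
      (for_loop 3 n_e (for_loop 4 n_e consider_cmd)))).

(** * Correctness of the program *)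

Section Correct.
Variables (n : nat) (h : history n).
Hypotheses (n4 : 4 <= n) (kn : k <= n) (hn : size h <= n ^ 2).
Let inp := encode h.

Lemma n_sq : n <= n ^ 2.
Proof. by rewrite -{1}[n]expn1 leq_pexp2l // (leq_trans _ n4). Qed.

Lemma eval_part m e : eval inp m (part_e e) = part n k (eval inp m e).
Proof.
rewrite /part_e /part; elim: (index_iota 1 k) => [|i r IH]; first by rewrite big_nil.
by rewrite big_cons -IH -[n]/(eval inp m n_e) -!eval_mul -eval_le.
Qed.

Lemma eval_in_part m e :
  (eval inp m (in_part_e e) != 0) = (part n k (eval inp m e) == m 2).
Proof. by rewrite eval_eq eval_part. Qed.

Lemma eval_turn x0 m i c : c <= 2 -> i < size h -> m 5 = i ->
  eval inp m (turn_e c) = nth 0 (encode_turn (nth x0 h i)) c.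
Proof.
move=> c2 ih mi.
have -> : eval inp m (turn_e c) = nth 0 inp (2 + c + 3 * i).
  by rewrite -[in RHS]mi -[m 5]/(eval inp m (cell 5)) -eval_mul.
rewrite /inp /encode -addnA /=; move: ih.
elim: h i {mi} c c2 => // x r IH [|i] c c2 ih.
  by rewrite muln0 addn0 /=; case: c c2 => [|[|[|]]].
rewrite -[map _ (x :: r)]/(encode_turn x :: map (@encode_turn n) r) /=.
by rewrite (_ : c + 3 * i.+1 = (c + 3 * i).+3) /= ?IH //; lia.
Qed.

Lemma turnP i : i < size h -> exists2 x : turn n,
  take i.+1 h = rcons (take i h) x & forall m, m 5 = i ->
  [/\ (eval inp m (turn_e 0) != 0) = x.1, eval inp m (turn_e 1) = src x
    & eval inp m (turn_e 2) = tgt x].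
Proof.
move=> ih; have x0 : turn n by case: h ih.
exists (nth x0 h i) => [|m mi]; first exact: take_nth.
by split; rewrite (eval_turn x0 _ ih mi) //; case: (nth x0 h i) => -[].
Qed.

Definition stores (s : track) (m : memory) : Prop :=
  forall x, x < n -> m (20 + (x + x)) = labels s x /\ m (21 + (x + x)) = claims s x.

(** Unlike [same_but], this allows the labels and claims, stored from cell 20 on, to change. *)
Definition same_scalars (l : seq nat) (m m' : memory) : Prop :=
  forall c, c < 20 -> c \notin l -> m' c = m c.

Lemma stores_same l s m m' : all (fun c => c < 20) l -> same_but l m m' ->
  stores s m -> stores s m'.
Proof.
move=> /allP l20 sm st x /st[lx cx]; rewrite !sm //;
  by apply/negP => /l20; lia.
Qed.

Lemma stores_label s m x y : stores s m -> y < n ->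
  stores (Track (fun z => if z == y then x else labels s z) (claims s))
    (write m (20 + (y + y)) x).
Proof.
move=> st yn z zn; have [lz cz] := st z zn; rewrite /write /=; split.
  by rewrite (_ : (_ == _) = (z == y)) ?lz //; lia.
by rewrite ifN ?cz //; lia.
Qed.

Lemma stores_claims s m x y : stores s m -> y < n ->
  stores (Track (labels s) (fun z => if z == y then x else claims s z))
    (write m (21 + (y + y)) x).
Proof.
move=> st yn z zn; have [lz cz] := st z zn; rewrite /write /=; split.
  by rewrite ifN ?lz //; lia.
by rewrite (_ : (_ == _) = (z == y)) ?cz //; lia.
Qed.

Lemma stores_ext s s' m :
  (forall x, x < n -> labels s x = labels s' x /\ claims s x = claims s' x) ->
  stores s m -> stores s' m.
Proof. by move=> E st x xn; have [<- <-] := E x xn; apply: st. Qed.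

Local Notation run c m Q := (achieves inp n c m Q).
Let run_skip := @achieves_skip inp n n4.
Let run_assign := @achieves_assign inp n n4.
Let run_seq := @achieves_seq inp n n4.
Let run_if := @achieves_if inp n n4.
Let run_for := @achieves_for inp n n4.

Lemma eval_lab_cell m e : eval inp m (lab_cell e) = 20 + (eval inp m e + eval inp m e).
Proof. by []. Qed.

Lemma init_correct m : run init_cmd m
  (fun m' => stores (Track id (fun=> 0)) m' /\
             forall c, c < 20 -> c != 6 -> m' c = m c).
Proof.
pose Inv a (m' : memory) :=
  (forall x, x < a -> m' (20 + (x + x)) = x /\ m' (21 + (x + x)) = 0) /\
  (forall c, c < 20 -> c != 6 -> m' c = m c).
apply: (run_for (N := n) (Inv := Inv)) => //; first exact: n_sq.
  by split=> // c _ c6; rewrite write_neq.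
move=> a m' an m6 [st sm].
apply/run_seq/run_assign/run_assign; rewrite /= !write_neq // !m6; split=> //.
split=> [x xa|c c20 c6]; last first.
  by rewrite !write_neq ?sm //; apply/eqP; lia.
rewrite /write; case: (ltngtP x a) => [xa'| |->]; [|lia|].
  by have [lx cx] := st x xa'; split; rewrite !ifN ?lx ?cx //; lia.
by split; do 4?case: eqP => //; lia.
Qed.

Lemma relabel_correct s m dead live : stores s m -> m 8 = dead -> m 9 = live ->
  run (for_loop 6 n_e (If (eq_e (lab_e (cell 6)) (cell 8))
        (Assign (lab_cell (cell 6)) (cell 9)) Skip)) m
  (fun m' => stores (Track (fun x => if labels s x == dead then live else labels s x)
                      (claims s)) m' /\
             forall c, c < 20 -> c != 6 -> m' c = m c).
Proof.
move=> st m8 m9.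
(* The state halfway through the loop: vertices below [a] are already relabelled. *)
pose relabel a x := if (x < a) && (labels s x == dead) then live else labels s x.
pose Inv a (m' : memory) := stores (Track (relabel a) (claims s)) m' /\
  (forall c, c < 20 -> c != 6 -> m' c = m c).
apply: (run_for (N := n) (Inv := Inv)) => //; first exact: n_sq.
- split; last by move=> c _ c6; rewrite write_neq.
  by apply: (@stores_same [:: 6] _ m) => //; apply: same_but_write.
- move=> a m' an m6 [st' sm]; apply: run_if; rewrite eval_eq /= m6 (sm 8) // m8.
  have [la _] := st' a an; rewrite la /= /relabel ltnn /=.
  have keep m'' : stores (Track (relabel a.+1) (claims s)) m'' ->
      (forall c, c < 20 -> c != 6 -> m'' c = m' c) -> m'' 6 = m' 6 ->
      m'' 6 = a /\ Inv a.+1 (write m'' 6 a.+1).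
    move=> st'' sm'' ->; split=> //; split; last first.
      by move=> c c20 c6; rewrite write_neq // sm'' // sm.
    by apply: (@stores_same [:: 6] _ m'') => //; apply: same_but_write.
  case: eqP => [ld|ld].
    apply: run_assign; rewrite /= m6 (sm 9) // m9; apply: keep.
    + apply: stores_ext (stores_label live st' an) => x xn /=; split=> //.
      rewrite /relabel; case: (ltngtP x a) => [xa|xa|->]; rewrite ?ltnS.
      * by rewrite ltnW.
      * by rewrite leqNgt xa.
      * by rewrite leqnn ld eqxx.
    + by move=> c c20 _; rewrite write_neq //; apply/eqP; lia.
    + by rewrite write_neq //; apply/eqP; lia.
  apply: run_skip; apply: keep => //.
  apply: stores_ext st' => x xn /=; split=> //; rewrite /relabel [x < a.+1]ltnS [x <= a]leq_eqVlt.
  by case: (x =P a) => [->|//]; rewrite ltnn /=; case: eqP.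
- move=> m' [st' sm]; split=> //; apply: stores_ext st' => x xn /=; split=> //.
  by rewrite /relabel xn.
Qed.

(** The expressions [a] and [b] are evaluated several times while cells 8 and 9 are written, hence
    the quantification over memories. *)
Lemma merge_correct s m u v a b : (forall x, x < n -> labels s x < n) ->
  stores s m -> u < n -> v < n ->
  (forall m', same_but [:: 6; 8; 9] m m' -> eval inp m' a = u) ->
  (forall m', same_but [:: 6; 8; 9] m m' -> eval inp m' b = v) ->
  run (merge_cmd a b) m (fun m' => stores (merge s u v) m' /\
    same_scalars [:: 6; 8; 9] m m').
Proof.
move=> ls st un vn au bv; apply: run_seq.
have labE x e m' : x < n -> eval inp m' e = x -> stores s m' ->
    eval inp m' (lab_e e) = labels s x.
  by move=> xn ex st'; rewrite /= ex; have [] := st' x xn.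
have claimsE x e m' : x < n -> eval inp m' e = x -> stores s m' ->
    eval inp m' (claims_e e) = claims s x.
  by move=> xn ex st'; rewrite /= ex; have [] := st' x xn.
have sm0 : same_but [:: 6; 8; 9] m m by [].
have lu := labE _ _ _ un (au _ sm0) st; have lv := labE _ _ _ vn (bv _ sm0) st.
have go x y p q : x < n -> y < n ->
    (forall m', same_but [:: 6; 8; 9] m m' -> eval inp m' p = x) ->
    (forall m', same_but [:: 6; 8; 9] m m' -> eval inp m' q = y) ->
    merge s u v = Track (fun z => if labels s z == labels s x then labels s y
      else labels s z) (claims s) ->
    run (Seq (Assign (Const 8) (lab_e p)) (Assign (Const 9) (lab_e q))) m
      (fun m1 => run (for_loop 6 n_e (If (eq_e (lab_e (cell 6)) (cell 8))
        (Assign (lab_cell (cell 6)) (cell 9)) Skip)) m1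
      (fun m' => stores (merge s u v) m' /\
        same_scalars [:: 6; 8; 9] m m')).
  move=> xn yn px qy ->; apply/run_seq/run_assign/run_assign.
  rewrite [eval _ _ (Const 8)]/= [eval _ _ (Const 9)]/=.
  rewrite (labE _ _ _ xn (px _ sm0) st).
  set m1 := write m 8 _; have sm1 : same_but [:: 6; 8; 9] m m1.
    exact: same_but_write.
  have st1 : stores s m1 by exact: (stores_same _ sm1 st).
  rewrite (labE _ _ _ yn (qy _ sm1) st1); set m2 := write m1 9 _.
  have sm2 : same_but [:: 6; 8; 9] m m2 by apply: same_but_write.
  have st2 : stores s m2 by exact: (stores_same _ sm2 st).
  apply: achieves_weaken (relabel_correct st2 (dead := labels s x)
    (live := labels s y) _ _) _ => // m' [st' sm']; split=> // c c20 cl.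
  rewrite sm' ?sm2 //.
  by apply: contraNneq cl => ->.
apply: run_if; rewrite eval_le_neq0.
rewrite (claimsE _ _ _ (ls _ un) lu st) (claimsE _ _ _ (ls _ vn) lv st).
have := erefl (merge s u v); rewrite {2}/merge; case: ifP => _ mE.
  exact: (go v u).
exact: (go u v).
Qed.

Lemma turn_correct s m (x : turn n) : (forall y, y < n -> labels s y < n) -> stores s m ->
  (forall m', m' 5 = m 5 -> [/\ (eval inp m' (turn_e 0) != 0) = x.1,
     eval inp m' (turn_e 1) = src x & eval inp m' (turn_e 2) = tgt x]) ->
  run turn_cmd m (fun m' => stores (track_step k (m 2) s x) m' /\
                            same_scalars [:: 6; 8; 9] m m').
Proof.
move=> ls st ev; have [e0 e1 e2] := ev m erefl.
have un := src_lt x; have vn := tgt_lt x.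
have incr s' m' e y : stores s' m' -> y < n -> eval inp m' e = y ->
    run (incr_cmd e) m' (fun m'' =>
      stores (Track (labels s') (fun z => claims s' z + (z == y))) m'' /\
      same_scalars [::] m' m'').
  move=> st' yn ey; apply: run_assign; rewrite /= ey; split.
    apply: stores_ext (stores_claims _ st' yn) => z zn /=; split=> //.
    have [_ ->] := st' y yn.
    by case: eqP => [->|_]; rewrite ?addn0.
  by move=> c c20 _; rewrite write_neq //; apply/eqP; lia.
apply: run_if; rewrite e0 /track_step; case: (x.1).
  apply: run_if; rewrite eval_in_part e1; case: (part n k (src x) == m 2).
    apply: run_if; rewrite eval_in_part e2; case: (part n k (tgt x) == m 2).
      by apply: merge_correct => // m' sm; have [] := ev m' _; rewrite ?sm.
    apply: run_assign; rewrite eval_lab_cell e1 e2; split; first exact: stores_label.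
    by move=> c c20 _; rewrite write_neq //; apply/eqP; lia.
  apply: run_if; rewrite eval_in_part e2; case: (part n k (tgt x) == m 2).
    apply: run_assign; rewrite eval_lab_cell e1 e2; split; first exact: stores_label.
    by move=> c c20 _; rewrite write_neq //; apply/eqP; lia.
  exact: run_skip.
apply/run_seq/run_if; rewrite eval_in_part e2.
(* The state between the two increments; the suffices step handles the second one from there. *)
set s1 := Track (labels s)
  (fun z => claims s z + ((z == src x) && (part n k (tgt x) == m 2))).
suff : forall m', stores s1 m' -> same_scalars [::] m m' -> run
    (If (in_part_e (turn_e 1)) (incr_cmd (turn_e 2)) Skip) m' (fun m'' =>
    stores (Track (labels s) (fun y => claims s y +
      ((y == src x) && (part n k (tgt x) == m 2)) +
      ((y == tgt x) && (part n k (src x) == m 2)))) m'' /\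
    same_scalars [:: 6; 8; 9] m m'').
  rewrite {}/s1; case: ifP => tj step1.
    apply: achieves_weaken (incr s m _ (src x) st un e1) _ => m' [st' sm'].
    by apply: step1 => //; apply: stores_ext st' => z zn; rewrite /= andbT.
  apply: run_skip; apply: step1 => //.
  by apply: stores_ext st => z zn; rewrite /= andbF addn0.
move=> m' st1 sm1; apply: run_if; have [_ f1 f2] := ev m' (sm1 5 isT isT).
rewrite eval_in_part f1 (sm1 2) //; case: ifP => sj.
  apply: achieves_weaken (incr s1 m' _ (tgt x) st1 vn f2) _ => m'' [st2 sm2].
  split; last by move=> c c20 _; rewrite sm2 ?sm1.
  by apply: stores_ext st2 => z zn; rewrite /= andbT.
apply: run_skip; split; last by move=> c c20 _; rewrite sm1.
by apply: stores_ext st1 => z zn; rewrite /= andbF addn0.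
Qed.

Lemma replay_correct m : stores (Track id (fun=> 0)) m ->
  run (for_loop 5 size_e turn_cmd) m
    (fun m' => stores (track_of k (m 2) h) m' /\ same_scalars [:: 5; 6; 8; 9] m m').
Proof.
move=> st.
pose Inv a (m' : memory) := stores (track_of k (m 2) (take a h)) m' /\
  same_scalars [:: 5; 6; 8; 9] m m'.
apply: (run_for (N := size h) (Inv := Inv)) => //.
- split; first by rewrite take0; apply: (@stores_same [:: 5] _ m) => //;
    apply: same_but_write.
  by move=> c _ cl; rewrite write_neq //; apply: contraNneq cl => ->.
- move=> a m' ah m5 [st' sm'].
  have [x tE ev] := turnP ah.
  have [ls _ _ _ _ _ _] := track_okP k (m 2) (take a h).
  have := turn_correct ls st' (x := x); rewrite (sm' 2) //.
  move=> T; apply: achieves_weaken (T _) _ => [m'' m5''|m'' [st'' sm'']].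
    by apply: ev; rewrite m5''.
  split; first by rewrite (sm'' 5).
  split.
    rewrite tE track_rcons; apply: (@stores_same [:: 5] _ m'') => //.
    exact: same_but_write.
  move=> c c20 cl; rewrite write_neq; last by apply: contraNneq cl => ->.
  by rewrite sm'' ?sm' //; move: cl; rewrite !inE !negb_or => /and4P[_ -> -> ->].
- by move=> m' [st' sm']; rewrite take_size in st'.
Qed.

Lemma free_correct m :
  run free_cmd m (fun m' => (m' 11 != 0) = free h (m 3) (m 4) /\
                            same_but [:: 5; 11] m m').
Proof.
pose Inv a (m' : memory) := (m' 11 != 0) = free (take a h) (m 3) (m 4) /\
  same_but [:: 5; 11] m m'.
apply/run_seq/run_assign; apply: (run_for (N := size h) (Inv := Inv)) => //.
- split; first by rewrite /= take0 /free.
  by do 2!apply: same_but_write => //.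
- move=> a m' ah m5 [fr sm]; have [x tE ev] := turnP ah.
  have [_ e1 e2] := ev m' m5.
  apply: run_if; rewrite eval_or !eval_and !eval_eq e1 e2 /= !sm //.
  have fS : free (take a.+1 h) (m 3) (m 4) = free (take a h) (m 3) (m 4) && ~~ joins (m 3) (m 4) x.
    by rewrite /free tE has_rcons negb_or andbC.
  rewrite -/(joins (m 3) (m 4) x); case: ifP => jx.
    apply: run_assign; split=> //.
    split; first by rewrite fS jx andbF.
    by do 2!apply: same_but_write => //.
  apply: run_skip; split=> //; split; first by rewrite fS jx andbT.
  exact: same_but_write.
- by move=> m' [fr sm]; rewrite take_size in fr.
Qed.

Lemma out_correct s m : stores s m ->
  run out_cmd m (fun m' => m' 12 = out n k (m 2) s (m 3) /\
                           same_but [:: 6; 12] m m').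
Proof.
move=> st.
pose Inv a (m' : memory) := m' 12 =
  count (fun x => (part n k x == m 2) && (labels s x != m 3)) (iota 0 a) /\
  same_but [:: 6; 12] m m'.
apply/run_seq/run_assign; apply: (run_for (N := n) (Inv := Inv)) => //.
- exact: n_sq.
- split=> //.
  by do 2!apply: same_but_write => //.
- move=> a m' an m6 [cnt sm]; apply: run_if.
  rewrite eval_and eval_in_part eval_neq /= m6 (sm 2) // (sm 3) //.
  have [-> _] := stores_same (isT : all (fun c => c < 20) [:: 6; 12]) sm st an.
  have cS : count (fun x => (part n k x == m 2) && (labels s x != m 3)) (iota 0 a.+1)
      = m' 12 + ((part n k a == m 2) && (labels s a != m 3)).
    by rewrite -[a.+1]addn1 iotaD count_cat /= addn0 cnt.
  case: ifP => ca; rewrite ca in cS.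
    apply: run_assign; rewrite /=; split; first by rewrite write_neq.
    split; first by rewrite cS.
    by do 2!apply: same_but_write => //.
  apply: run_skip; split=> //; split; first by rewrite cS addn0.
  exact: same_but_write.
Qed.

(** [P] describes the pairs examined so far. Cell 10 strictly exceeds their scores, so it is 0 only
    if none of them was free, and otherwise the stored edge attains the maximum. *)
Definition best_among (P : nat -> nat -> Prop) (m : memory) : Prop :=
  (forall v w, v < n -> w < n -> v != w -> free h v w -> P v w ->
     score k h v w < m 10) /\
  (m 10 = 0 \/ exists v w, [/\ v < n, w < n, v != w, free h v w &
     [/\ m 10 = (score k h v w).+1, m 0 = minn v w & m 1 = maxn v w]]).

Lemma best_among_weaken (P P' : nat -> nat -> Prop) m m' :
  (forall v w, v < n -> w < n -> v != w -> free h v w -> P' v w -> P v w) ->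
  m' 0 = m 0 -> m' 1 = m 1 -> m' 10 = m 10 -> best_among P m -> best_among P' m'.
Proof.
move=> sub e0 e1 e10 [all_le ex]; rewrite /best_among e0 e1 e10; split=> //.
by move=> v w vn wn vw fr /(sub v w vn wn vw fr); apply: all_le.
Qed.

(** A pair that is skipped is degenerate, not free, or belongs to another track, so adding it to [P]
    imposes nothing new. *)
Lemma consider_correct P m : stores (track_of k (m 2) h) m -> m 3 < n -> m 4 < n ->
  best_among P m ->
  run consider_cmd m (fun m' => same_but [:: 0; 1; 5; 6; 10; 11; 12; 13] m m' /\
    best_among (fun v w => P v w \/ [/\ v = m 3, w = m 4 & part n k w = m 2]) m').
Proof.
move=> st vn wn best; set l := [:: 0; 1; _; _; _; _; _; _].
have skip m' : same_but [:: 5; 11] m m' ->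
    ~~ [&& part n k (m 4) == m 2, m 3 != m 4 & free h (m 3) (m 4)] ->
    run Skip m' (fun m' => same_but l m m' /\
      best_among (fun v w => P v w \/ [/\ v = m 3, w = m 4 & part n k w = m 2]) m').
  move=> sm no; apply: run_skip; split.
    by apply: same_but_trans sm => // c; rewrite !inE => /orP[] /eqP ->.
  apply: best_among_weaken best; rewrite ?sm // => v w _ _ vw fr [//|[E1 E2 E3]].
  by move: no; rewrite -E1 -E2 vw fr E3 eqxx.
apply: run_if; rewrite eval_and eval_in_part eval_neq.
rewrite [eval _ _ (cell 3)]/= [eval _ _ (cell 4)]/=.
case: ifP => cond; last by apply: skip => //; rewrite andbA cond.
apply: run_seq; apply: achieves_weaken (free_correct m) _ => m1 [fr sm1].
apply: run_if; rewrite [eval _ _ _]/= fr; case: ifP => fr1; last first.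
  by apply: skip => //; rewrite andbA cond fr1.
case/andP: cond => /eqP wj vw.
have st1 : stores (track_of k (m 2) h) m1 by apply: stores_same sm1 st.
apply: run_seq; apply: achieves_weaken (out_correct st1) _ => m2 [cnt sm2].
have {}st2 : stores (track_of k (m 2) h) m2 by apply: stores_same sm2 st1.
have e2 c : c \notin [:: 5; 11] -> c \notin [:: 6; 12] -> m2 c = m c.
  by move=> c1 c2; rewrite sm2 ?sm1.
have {fr sm1 st1 cnt} cnt : m2 12 = out n k (m 2) (track_of k (m 2) h) (m 3).
  by rewrite cnt !sm1.
have sm : same_but l m m2.
  move=> c; rewrite !inE !negb_or => cl; apply: e2; rewrite !inE !negb_or; lia.
have [lv cv] := st2 (m 3) vn; have [lw _] := st2 (m 4) wn.
set sc := score k h (m 3) (m 4).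
have score_step : run score_cmd m2 (fun m3 => m3 13 = sc.+1 /\ same_but [:: 13] m2 m3).
  apply: run_if; rewrite !eval_and eval_eq eval_neq eval_le_neq0 eval_mul.
  rewrite [eval _ _ (cell 12)]/= cnt [eval _ _ n_e]/= [eval _ _ (cell 3)]/=.
  rewrite [eval _ _ (lab_e _)]/= [eval _ _ (lab_e _)]/=.
  rewrite (e2 3) // (e2 4) // lv lw /sc /score wj -/(active n k _ _ _).
  case: ifP => _; apply: run_assign; split; try exact: same_but_write.
    by rewrite /= (e2 3) // cv /write /= addn2.
  by rewrite /= /write.
apply: run_seq; apply: achieves_weaken score_step _ => m3 [m13 sm3].
have keep c : c \notin l -> m3 c = m c.
  by move=> cl; rewrite sm3 ?sm //; apply: contraNN cl; rewrite !inE => ->; rewrite !orbT.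
have m10 : m3 10 = m 10 by rewrite sm3 // e2.
case: best => best1 best2.
apply: run_if; rewrite eval_lt [eval _ _ _]/= [eval _ _ _]/= m10 m13 ltnS.
case: leqP => better; last first.
  apply: run_skip; split=> //; rewrite /best_among m10 sm3 // sm3 // e2 // e2 //.
  split=> // v w v' w' vw' fr' [/best1|[-> -> _]]; first exact.
  exact: better.
apply/run_seq/run_assign/run_seq/run_assign/run_assign.
split.
  move=> c cl; rewrite /= !write_neq ?keep //;
    by apply: contraNneq cl => ->; rewrite ?inE.
rewrite /best_among /write /= (keep 3) // (keep 4) // m13; split.
  move=> v w v' w' vw' fr' [/best1 b|[-> -> _]]; last by [].
  by rewrite ltnS; apply: leq_trans better; apply: ltnW; apply: b.
right; exists (m 3), (m 4); split=> //; split=> //; lia.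
Qed.

Lemma scan_row_correct P j v m : stores (track_of k j h) m -> m 2 = j ->
  m 3 = v -> v < n -> best_among P m ->
  run (for_loop 4 n_e consider_cmd) m (fun m' =>
    [/\ stores (track_of k j h) m', m' 2 = j, m' 3 = v &
      best_among (fun v' w' => P v' w' \/ part n k w' = j /\ v' = v) m']).
Proof.
move=> st m2 m3 vn best.
pose Inv a (m' : memory) := [/\ stores (track_of k j h) m', m' 2 = j, m' 3 = v &
  best_among (fun v' w' => P v' w' \/ [/\ part n k w' = j, v' = v & w' < a]) m'].
apply: (run_for (N := n) (Inv := Inv)) => //.
- exact: n_sq.
- split=> //.
  by apply: best_among_weaken best => // v' w' _ _ _ _ [//|[]].
- move=> a m' an m4 [st' m2' m3' best'].
  have := @consider_correct (fun v' w' => P v' w' \/ [/\ part n k w' = j, v' = v & w' < a]) m'.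
  rewrite m2' m3' m4 => C; apply: achieves_weaken (C _ _ _ _) _ => // m'' [sm b].
  split; first by rewrite sm.
  have st'' : stores (track_of k j h) m'' by apply: stores_same sm st'.
  split; rewrite ?write_neq ?sm //.
  apply: best_among_weaken b => // v' w' _ _ _ _ [?|[? ?]]; first by do 2!left.
  rewrite ltnS leq_eqVlt => /orP[/eqP ?|?]; first by right.
  by left; right.
- move=> m' [st' m2' m3' best']; split=> //.
  by apply: best_among_weaken best' => // v' w' _ w'n _ _ [?|[? ?]]; [left|right].
Qed.

Lemma scan_correct P j m : stores (track_of k j h) m -> m 2 = j -> best_among P m ->
  run (for_loop 3 n_e (for_loop 4 n_e consider_cmd)) m (fun m' =>
    m' 2 = j /\ best_among (fun v w => P v w \/ part n k w = j) m').
Proof.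
move=> st m2 best.
pose Inv a (m' : memory) := [/\ stores (track_of k j h) m', m' 2 = j &
  best_among (fun v w => P v w \/ part n k w = j /\ v < a) m'].
apply: (run_for (N := n) (Inv := Inv)) => //.
- exact: n_sq.
- split=> //.
  by apply: best_among_weaken best => // v w _ _ _ _ [//|[]].
- move=> a m' an m3 [st' m2' best'].
  apply: achieves_weaken (scan_row_correct st' m2' m3 an best') _ => m'' [st'' m2'' m3'' b].
  split=> //; split=> //.
  apply: best_among_weaken b => // v w _ _ _ _ [?|[?]]; first by do 2!left.
  rewrite ltnS leq_eqVlt => /orP[/eqP ->|?]; first by right.
  by left; right.
- move=> m' [st' m2' best']; split=> //.
  by apply: best_among_weaken best' => // v w vn _ _ _ [?|?]; [left|right].
Qed.

(** Round [a] examines the pairs whose second vertex lies in part [a], so after [k] rounds every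
    pair has been examined. *)
Lemma move_cmd_correct : 0 < k ->
  run move_cmd (fun=> 0) (best_among (fun _ _ => True)).
Proof.
move=> k0.
pose Inv a (m : memory) := best_among (fun _ w => part n k w < a) m.
apply: (run_for (N := k) (Inv := Inv)) => //.
- exact: leq_trans kn n_sq.
- by split; last by left.
- move=> a m ak m2 best; apply: run_seq; apply: achieves_weaken (init_correct m) _.
  move=> m1 [st1 sm1]; apply: run_seq; apply: achieves_weaken (replay_correct st1) _.
  move=> m3 [st3 sm3]; rewrite (sm1 2) // m2 in st3.
  have m32 : m3 2 = a by rewrite sm3 // sm1.
  have best3 : best_among (fun _ w => part n k w < a) m3.
    by apply: best_among_weaken best => //; rewrite sm3 // sm1.
  apply: achieves_weaken (scan_correct st3 m32 best3) _ => m4 [m42 b]; split=> //.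
  apply: best_among_weaken b => // v w _ _ _ _.
  by rewrite ltnS leq_eqVlt => /orP[/eqP ->|?]; [right|left].
- move=> m; apply: best_among_weaken => // v w _ _ _ _ _.
  exact: part_lt.
Qed.

Lemma iter_halted t m w :
  iter t (step inp) (Config [::] m w) = Config [::] m w.
Proof. by elim: t => //= t ->. Qed.

Lemma move_cmd_outputs : 0 < k -> legal h -> size h < #|{: edge n}| ->
  exists2 e : edge n, best_move k h e & forall w e',
    outputs (Defs.run move_cmd inp w (n ^ level move_cmd)) e' = (e' == e).
Proof.
move=> k0 lh sh; have [t [m [tn runs [all_le ex]]]] := move_cmd_correct k0.
have [e0 ne0] := free_edge lh sh.
have [v [w [vn wn vw fr [m10 m0 m1]]]] : exists v w, [/\ v < n, w < n, v != w, free h v w &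
     [/\ m 10 = (score k h v w).+1, m 0 = minn v w & m 1 = maxn v w]].
  (* The ends of the free edge [e0] form an examined free pair, so cell 10 cannot still be 0. *)
  case: ex => // m10; have := all_le (val e0).1 (val e0).2 (ltn_ord _) (ltn_ord _).
  rewrite m10 => H; suff : false by []; apply: H => //.
    by rewrite neq_ltn (valP e0).
  apply/hasPn => x xh; apply: contraNN ne0 => /joinsP j.
  suff -> : e0 = x.2 by apply: map_f.
  apply: val_inj; have := src_tgt x; have := valP e0; move: j.
  rewrite /src /tgt; case: (val x.2) => a b; case: (val e0) => c d /=.
  case=> -[E1 E2]; first by move=> _ _; congr (_, _); apply: val_inj.
  by rewrite E1 E2 => ab /(ltn_trans ab); rewrite ltnn.
have [e je] := edge_ends vn wn vw; exists e.
  exists v, w; split=> // v' w' vn' wn' vw' fr'.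
  by have := all_le v' w' vn' wn' vw' fr' I; rewrite m10.
have [ve we] : minn v w = (val e).1 /\ maxn v w = (val e).2.
  have := src_tgt (true, e); have := je true.
  case/joinsP=> -[-> ->] lt; first by rewrite (minn_idPl (ltnW lt)) (maxn_idPr (ltnW lt)).
  by rewrite (minn_idPr (ltnW lt)) (maxn_idPl (ltnW lt)).
(* The program halts after [t] steps; the remaining ones are idle. *)
move=> bits e'; rewrite /Defs.run -(subnK tn) iterD runs iter_halted /outputs /=.
rewrite m0 m1 ve we -val_eqE -pair_eqE /pair_eq /= -!val_eqE /=.
by rewrite eq_sym [X in _ && X]eq_sym.
Qed.

End Correct.
End Program.

(** * The strategy *)

Section Strategy.
Local Open Scope ring_scope.
Variables (R : realFieldType) (k : nat).

Let degree := level (move_cmd k).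

(** The fallback to an arbitrary free edge makes this a strategy for every [n], including small [n],
    for which correctness of the program is not established. *)
Definition next_move (n : nat) (h : history n) : option (edge n) :=
  let reached e := outputs (run (move_cmd k) (encode h) [::] (n ^ degree)) e in
  if [pick e | (e \notin claimed h) && reached e] is Some e then Some e
  else [pick e | e \notin claimed h].

Lemma next_move_free n (h : history n) : legal h -> (size h < #|{: edge n}|)%N ->
  exists2 e, next_move h = Some e & e \notin claimed h.
Proof.
move=> lh sh; rewrite /next_move; case: pickP => [e /andP[fe _]|_]; first by exists e.
case: pickP => [e fe|none]; first by exists e.
by have [e] := free_edge lh sh; rewrite none.
Qed.

Lemma next_move_distribution n (h : history n) :
  legal h -> (size h < #|{: edge n}|)%N ->
  let move h e : R := (next_move h == Some e)%:R in
  [/\ forall e, 0 <= move h e, forall e, e \in claimed h -> move h e = 0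
    & \sum_e move h e = 1].
Proof.
move=> lh sh; have [e me fe] := next_move_free lh sh; rewrite /= me; split=> [e'|e' ce'|].
- exact: ler0n.
- by case: eqP => // -[ee']; rewrite ee' ce' in fe.
- rewrite (bigD1 e) //= eqxx big1 ?addr0 // => e' ne.
  by case: eqP => // -[ee']; rewrite ee' eqxx in ne.
Qed.

Definition maker_strategy (n : nat) : strategy R n :=
  Strategy (@next_move_distribution n).

Lemma size_le_sq n (h : history n) : (size h < #|{: edge n}|)%N -> (size h <= n ^ 2)%N.
Proof.
move=> /ltnW/leq_trans; apply; rewrite card_sub expnS expn1.
by apply: leq_trans (max_card _) _; rewrite card_prod card_ord.
Qed.

Lemma next_move_best n (h : history n) : (0 < k)%N -> (4 <= n)%N -> (k <= n)%N ->
  legal h -> (size h < #|{: edge n}|)%N ->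
  exists e, [/\ next_move h = Some e, best_move k h e & forall w e',
    outputs (run (move_cmd k) (encode h) w (n ^ degree)) e' = (e' == e)].
Proof.
move=> k0 n4 kn lh sh.
have [e be oe] := move_cmd_outputs n4 kn (size_le_sq sh) k0 lh sh.
exists e; split=> //; rewrite /next_move.
case: pickP => [e' /andP[_]|/(_ e)]; rewrite /degree oe; first by move/eqP ->.
rewrite eqxx andbT; case: be => v [w [_ _ vw fr _]] /negbFE/mapP[x xh ex].
case/hasP: fr; exists x => //.
by move: vw; rewrite /joins /src /tgt /= ex.
Qed.

Lemma maker_strategy_efficient : (0 < k)%N -> efficient maker_strategy.
Proof.
move=> k0; exists (move_cmd k), degree, (maxn 4 k) => n.
rewrite geq_max => /andP[n4 kn] h lh sh.
have [e [me _ oe]] := next_move_best k0 n4 kn lh sh; split=> [w|e'].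
  by exists e; rewrite oe.
(* The output ignores the random bits, so either all words or none lead to [e']. *)
have -> : [set w : (n ^ degree).-tuple bool |
    outputs (run (move_cmd k) (encode h) w (n ^ degree)) e']%SET =
    if e' == e then [set: (n ^ degree).-tuple bool]%SET else finset.set0.
  by apply/finset.setP => w; rewrite inE oe; case: eqP; rewrite inE.
rewrite /= me (_ : (Some e == Some e') = (e' == e)); last by rewrite eq_sym.
case: eqP => _; last by rewrite cards0 mul0r.
by rewrite cardsT card_tuple card_bool natrX divff // expf_neq0 // pnatr_eq0.
Qed.

End Strategy.

(** * The probability of failure *)

Section Bounds.
Local Open Scope ring_scope.

Lemma maker_strategy_wins (R : realFieldType) (k n : nat) (p : R)
    (B : strategy R n) : (0 < k)%N -> (4 <= n)%N -> (3 * k <= n)%N -> 0 <= p <= 1 ->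
  1 - (n * k)%:R / (1 + p / 2) ^+ (n %/ (3 * k)) <=
  maker_win_prob p (maker_strategy R k n) B k.
Proof.
move=> k0 n4 kn p01; have kn' : (k <= n)%N by lia.
apply: (@le_trans _ _ (safety k p [::])).
  rewrite /safety le_max lerD2l lerN2; apply/orP; right.
  by apply: le_trans (potential_start n k p01) _; rewrite expr0 mul1r.
apply: (maker_win_prob_ge p01 (V := safety k p)) => h lh sh.
  have [e [me be _]] := next_move_best k0 n4 kn' lh sh.
  apply: (safety_submartingale p01 B k0 lh sh (e0 := e)) => // e'.
  by rewrite /= me; congr (nat_of_bool _)%:R; rewrite eq_sym.
rewrite /safety ge_max ler0n /=; have [win|] := boolP (maker_wins k h).
  by rewrite lerBlDr lerDl potential_ge0.
(* Positive safety at the end means potential below 1, hence no active label. *)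
apply: contraNT; rewrite -ltNge subr_gt0 => X1.
apply/existsP; exists (maker_edges h); rewrite fintype.subxx /=.
by apply: inactive_connected => // j v; apply: inactive_of_potential X1 _ _.
Qed.

(** The constant 48 comes from [1 + p / 2 >= e ^ (p / 4)] and [T >= n / (6 k)]: the power is at
    least [e ^ (p n / (24 k))], which is at least [n ^ 2]. *)
Lemma exp_bound (R : realType) (k n : nat) (p : R) : (0 < k)%N -> (6 * k <= n)%N ->
  0 <= p <= 1 -> (48 * k)%:R * ln n%:R / n%:R <= p ->
  (n * k)%:R / (1 + p / 2) ^+ (n %/ (3 * k)) <= k%:R / n%:R.
Proof.
move=> k0 kn /andP[p0 p1] pge; set T := (n %/ (3 * k))%N.
have n0 : 0 < n%:R :> R by rewrite ltr0n; lia.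
have T_ge : n%:R <= (6 * k)%:R * T%:R :> R.
  rewrite -natrM ler_nat /T; have := divn_eq n (3 * k).
  have : (n %% (3 * k) < 3 * k)%N by rewrite ltn_mod; lia.
  have : (2 <= n %/ (3 * k))%N by rewrite leq_divRL; lia.
  by nia.
(* Through [1 - p / 4], using [(1 - p / 4) (1 + p / 2) >= 1] for [p] in the unit interval. *)
have inv_le : (1 + p / 2)^-1 <= expR (- (p / 4)).
  apply: le_trans (expR_ge1Dx _); rewrite -[X in X <= _]mul1r ler_pdivrMr; last by lra.
  have : 0 <= p * (1 - p) by rewrite mulr_ge0 ?subr_ge0.
  by nra.
have pow_le : (1 + p / 2) ^- T <= expR (- (2 * ln n%:R)).
  rewrite -exprVn; apply: (@le_trans _ _ (expR (- (p / 4)) ^+ T)).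
    by rewrite lerXn2r // ?nnegrE ?expR_ge0 // invr_ge0; lra.
  rewrite -expRM_natl ler_expR mulrN lerN2.
  have : ln n%:R * (48 * k)%:R <= p * n%:R :> R.
    by rewrite mulrC -ler_pdivrMr.
  have : p * n%:R <= p * ((6 * k)%:R * T%:R) by rewrite ler_wpM2l.
  move=> H1 H2; have := le_trans H2 H1; rewrite !natrM => {H1 H2}.
  have k0' : 0 < k%:R :> R by rewrite ltr0n.
  by rewrite -subr_ge0 => H; rewrite -subr_ge0 -(pmulr_rge0 _ k0'); lra.
apply: le_trans (ler_wpM2l _ pow_le) _; first exact: ler0n.
rewrite expRN expRM_natl lnK ?posrE // natrM expr2.
have n0' : n%:R != 0 :> R by rewrite lt0r_neq0.
by rewrite invfM mulrA [_ * k%:R]mulrC mulfK.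
Qed.

End Bounds.

Local Open Scope classical_set_scope.
Local Open Scope ring_scope.

Theorem theorem1p7 (R : realType) (k : nat) (hk : (0 < k)%N) :
  exists C3 : R, 0 < C3 /\
  forall p : nat -> R,
    (forall n, 0 <= p n <= 1) ->
    (\forall n \near \oo, C3 * ln n%:R / n%:R <= p n) ->
    exists M : forall n, strategy R n,
      efficient M /\
      forall eps : R, 0 < eps ->
        \forall n \near \oo, forall B : strategy R n,
          1 - eps <= maker_win_prob (p n) (M n) B k.
Proof.
exists (48 * k)%:R; split; first by rewrite ltr0n; lia.
move=> p p01 p_ge; exists (maker_strategy R k).
split=> [|eps eps0]; first exact: maker_strategy_efficient.
near=> n => B.
have n4 : (4 <= n)%N by near: n; apply: nbhs_infty_ge.
have kn : (6 * k <= n)%N by near: n; apply: nbhs_infty_ge.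
have n_eps : k%:R / eps <= n%:R by near: n; apply: nbhs_infty_ger.
apply: le_trans (maker_strategy_wins B hk n4 _ (p01 n)); last by lia.
rewrite lerD2l lerN2; apply: le_trans (exp_bound hk kn (p01 n) _) _.
  by near: n.
by rewrite ler_pdivrMr ?ltr0n ?(leq_trans _ n4) // mulrC -ler_pdivrMr.
Unshelve. all: by end_near.
Qed.
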